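(* Every MRT multiplicative function is aperiodic (i.e. non-pretentious).
   Context: $\mathbb N=\{1,2,\ldots\}$, $\mathbb P$ is the set of primes, $\mathbb S^1$ is the complex unit circle, $\mathbb U$ is the closed complex unit disc. A completely multiplicative function $f\colon\mathbb N\to\mathbb S^1$ (i.e. $f(mn)=f(m)f(n)$ for all $m,n\in\mathbb N$) is an MRT multiplicative function if there exist strictly increasing sequences of integers $(t_m)$, with $t_1:=1$, and $(s_m)$ such that for each $m\in\mathbb N$: (i) $t_m<s_{m+1}<s_{m+1}^2\le t_{m+1}$; (ii) $f(p)=p^{is_{m+1}}$ for each prime $p\in(t_m,t_{m+1}]$; (iii) $|f(p)-p^{is_{m+1}}|\le 1/t_m^2$ for each prime $1<p\le t_m$. For multiplicative $f,g\colon\mathbb N\to\mathbb U$ let $\mathbb D^2(f,g)=\sum_{p\in\mathbb P}\frac1p\big(1-\mathrm{Re}(f(p)\overline{g(p)})\big)$ and write $f\sim g$ if $\mathbb D(f,g)<+\infty$. $f$ is pretentious if $f\sim n^{it}\cdot\chi$ for some $t\in\mathbb R$ and some primitive Dirichlet character $\chi$ (the constant $\chi=1$, with conductor $1$, is regarded as primitive), and aperiodic (non-pretentious) otherwise. *)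

(* Defs.v *)
From HB Require Import structures.
From mathcomp Require Import all_boot all_order all_algebra.
From mathcomp Require Import all_classical all_reals all_analysis.
From mathcomp Require Import complex.
Set Implicit Arguments.
Unset Strict Implicit.
Unset Printing Implicit Defensive.
Import Order.TTheory GRing.Theory Num.Theory.
Local Open Scope ring_scope.
Local Open Scope complex_scope.

(* Arithmetic functions on {1, 2, ...} are rendered as functions on [nat] whose
   value at 0 plays no role; likewise sequences indexed by {1, 2, ...}. *)

Definition completely_multiplicative (R : realType) (f : nat -> R[i]) : Prop :=
  forall m n : nat, (0 < m)%N -> (0 < n)%N -> f (m * n)%N = f m * f n.

Definition circle_valued (R : realType) (f : nat -> R[i]) : Prop :=
  forall n : nat, (0 < n)%N -> `|f n| = 1.

(* n^{iu} = exp(i u log n), for n > 0 *)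
Definition npowi (R : realType) (u : R) (n : nat) : R[i] :=
  cos (u * ln n%:R) +i* sin (u * ln n%:R).

Definition strictly_increasing_from1 (a : nat -> int) : Prop :=
  forall m n : nat, (0 < m)%N -> (m < n)%N -> a m < a n.

Definition is_MRT (R : realType) (f : nat -> R[i]) : Prop :=
  [/\ completely_multiplicative f,
      circle_valued f &
      exists t s : nat -> int,
        [/\ strictly_increasing_from1 t,
            strictly_increasing_from1 s,
            t 1%N = 1 &
            forall m : nat, (0 < m)%N ->
              [/\ [/\ t m < s m.+1, s m.+1 < s m.+1 ^+ 2
                    & s m.+1 ^+ 2 <= t m.+1],
                  forall p : nat, prime p -> t m < p%:Z <= t m.+1 ->
                    f p = npowi (s m.+1)%:~R p &
                  forall p : nat, prime p -> 1 < p%:Z <= t m ->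
                    `|f p - npowi (s m.+1)%:~R p| <= 1 / (t m)%:~R ^+ 2]]].

(* The square of the pretentious distance, possibly +oo *)
Definition distance2 (R : realType) (f g : nat -> R[i]) : \bar R :=
  (\sum_(0 <= p <oo | prime p)
     (p%:R^-1 * (1 - complex.Re (f p * (g p)^*)))%:E)%E.

Definition distance (R : realType) (f g : nat -> R[i]) : \bar R :=
  sqrte (distance2 f g).

Definition pretends (R : realType) (f g : nat -> R[i]) : Prop :=
  (distance f g < +oo)%E.

Definition dirichlet_character (R : realType) (q : nat) (chi : nat -> R[i])
    : Prop :=
  [/\ (0 < q)%N,
      forall m n : nat, m = n %[mod q] -> chi m = chi n,
      forall m n : nat, chi (m * n)%N = chi m * chi n &
      forall n : nat, chi n != 0 <-> coprime n q].

(* For q = 1 there is no smaller modulus, so the constant 1 is primitive. *)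
Definition primitive_character (R : realType) (q : nat) (chi : nat -> R[i])
    : Prop :=
  dirichlet_character q chi /\
  forall d : nat, (d %| q)%N -> (d < q)%N ->
    ~ exists psi : nat -> R[i], dirichlet_character d psi /\
        forall n : nat, coprime n q -> chi n = psi n.

Definition pretentious (R : realType) (f : nat -> R[i]) : Prop :=
  exists (u : R) (q : nat) (chi : nat -> R[i]),
    primitive_character q chi /\ pretends f (fun n => npowi u n * chi n).

Definition aperiodic (R : realType) (f : nat -> R[i]) : Prop :=
  ~ pretentious f.

(* Main.v *)
Require Import Defs.
From mathcomp Require Import all_boot all_order all_algebra.
From mathcomp Require Import all_classical all_reals all_analysis.
From mathcomp Require Import complex.
From mathcomp Require Import ring lra zify.
Set Implicit Arguments.
Unset Strict Implicit.
Unset Printing Implicit Defensive.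
Import Order.TTheory GRing.Theory Num.Theory.
Import numFieldNormedType.Exports.
Import ComplexField.Normc.
Local Open Scope ring_scope.
Local Open Scope complex_scope.

(** Let f be an MRT function and suppose that f pretends to be n^{iu} chi, with
    chi of modulus q.  Raising to the power k = phi(q) removes chi: by
    one_sub_ReX, the sum over primes of (1 - Re(f(p)^k p^{-iku}))/p converges.
    Let s = s_{m+1} and t = k(s - u).  On the primes up to t_{m+1}, hence on
    those up to s^2, f(p)^k p^{-iku} equals p^{it} up to an error which is at
    most k/t_m^2 and occurs only for p <= t_m.  So, once N is large and then m
    is large in terms of N, the sum of (1 - cos(t ln p))/p over N < p <= s^2 is
    arbitrarily small.  This is impossible: prime_oscillation bounds that sum
    below by an absolute positive constant, because t is of the same order as s.

    The lower bound comes from the Dirichlet series of n^{-(1+d)} and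
    n^{-(1+d+it)} over the n with no prime factor at most N, with d = K / ln s
    for a large absolute constant K.  If p^{it} were close to 1 for nearly all
    primes p > N, then the two Euler products would have nearly the same modulus
    (euler_product, euler_products_cmp).  But the oscillating series is
    essentially determined by its terms with n up to a constant times s: beyond
    that point n^{-(1+d+it)} is nearly a difference of values of n^{-(d+it)} at
    points N! apart, and the sum telescopes (oscillating_tail).  The
    positive series has in addition its terms between s and s^{3/2}.  They are a
    positive proportion of the whole, and this proportion is independent of N
    because the density of the integers coprime to N! cancels
    (rough_inv_sum_le, inv_sum_blocks_ge).

    The primes above s^2 escape control and must be charged in full, but the
    weight p^{-d} makes them cheap: their cost is of order s^{-2d}, by
    sum_primes_rpow_le, whereas the gain between s and s^{3/2} is of order
    s^{-3d/2}.  Since s^{-d} = e^{-K}, a large K decides in favour of the gain.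
    Removing the primes up to N from the Euler product is necessary, since
    nothing makes p^{it} close to 1 for small p; the convergence of the distance
    only gives smallness for the tail. *)

(** * Logarithms and the modulus of complex numbers *)

Lemma ln_sub_bounds (R : realType) (x y : R) : 0 < x -> x <= y ->
  (y - x) / y <= ln y - ln x <= (y - x) / x.
Proof.
move=> x0 xy; have y0 : 0 < y by apply: lt_le_trans xy.
have ub (a b : R) : 0 < a -> 0 < b -> ln b - ln a <= (b - a) / a.
  move=> a0 b0; rewrite -ln_div ?posrE //.
  have -> : b / a = 1 + (b - a) / a by field; rewrite gt_eqF.
  apply: le_ln1Dx; rewrite mulrBl divff ?gt_eqF //.
  have : 0 < b / a by rewrite divr_gt0.
  lra.
rewrite ub // andbT -lerN2 opprB -mulNr opprB; exact: ub.
Qed.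

Lemma normc_real (R : rcfType) (x : R) : normc x%:C = `|x|.
Proof. by rewrite /= expr0n /= addr0 sqrtr_sqr. Qed.

Lemma normc_ge0 (R : rcfType) (z : R[i]) : 0 <= normc z.
Proof. by case: z => x y; rewrite sqrtr_ge0. Qed.

Lemma normc_le_sum (R : rcfType) (I : Type) (r : seq I) (P : pred I)
    (F : I -> R[i]) :
  normc (\sum_(i <- r | P i) F i) <= \sum_(i <- r | P i) normc (F i).
Proof.
elim/big_rec2: _ => [|i y x _ le]; first by rewrite normc0.
by apply: le_trans (le_normcD _ _) _; rewrite lerD2l.
Qed.

Lemma normcB (R : rcfType) (x y : R[i]) : normc (x - y) = normc (y - x).
Proof. by rewrite -normcN opprB. Qed.

Lemma normc_prod (R : rcfType) (I : Type) (r : seq I) (P : pred I)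
    (F : I -> R[i]) :
  normc (\prod_(i <- r | P i) F i) = \prod_(i <- r | P i) normc (F i).
Proof. by apply: (big_morph (@normc R)); [exact: normcM | exact: normc1]. Qed.

(** * The functions n^{-d} and n^{-(d+it)} *)

(** n^{-d}; the sign is in the definition because only decaying powers occur. *)
Definition rpow (R : realType) (d : R) (n : nat) : R := expR (- (d * ln n%:R)).

(** n^{-(d+it)}. *)
Definition npow (R : realType) (d t : R) (n : nat) : R[i] :=
  (rpow d n)%:C * npowi (- t) n.

Lemma lnM_nat (R : realType) (m n : nat) : (0 < m)%N -> (0 < n)%N ->
  ln (m * n)%:R = ln m%:R + ln n%:R :> R.
Proof. by move=> m0 n0; rewrite natrM lnM // posrE ltr0n. Qed.

Lemma npowiM (R : realType) (t : R) (m n : nat) : (0 < m)%N -> (0 < n)%N ->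
  npowi t (m * n) = npowi t m * npowi t n.
Proof.
move=> m0 n0; rewrite /npowi lnM_nat // mulrDr cosD sinD; simpc.
by congr (_ +i* _); rewrite addrC.
Qed.

Lemma normc_npowi (R : realType) (t : R) (n : nat) : normc (npowi t n) = 1.
Proof. by rewrite /= cos2Dsin2 sqrtr1. Qed.

Lemma npowM (R : realType) (d t : R) (m n : nat) : (0 < m)%N -> (0 < n)%N ->
  npow d t (m * n) = npow d t m * npow d t n.
Proof.
move=> m0 n0; rewrite /npow npowiM // /rpow lnM_nat // mulrDr opprD expRD rmorphM.
by rewrite mulrACA.
Qed.

Lemma normc_npow (R : realType) (d t : R) (n : nat) :
  normc (npow d t n) = rpow d n.
Proof. by rewrite normcM normc_npowi mulr1 normc_real ger0_norm // expR_ge0. Qed.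

Lemma npow0 (R : realType) (d : R) (n : nat) : npow d 0 n = (rpow d n)%:C.
Proof. by rewrite /npow /npowi oppr0 mul0r cos0 sin0 mulr1. Qed.

Lemma rpow_gt0 (R : realType) (d : R) (n : nat) : 0 < rpow d n.
Proof. exact: expR_gt0. Qed.

Lemma rpowD1 (R : realType) (d : R) (n : nat) : (0 < n)%N ->
  rpow (1 + d) n = n%:R^-1 * rpow d n.
Proof.
move=> n0; rewrite /rpow mulrDl opprD expRD mul1r; congr (_ * _).
by rewrite expRN lnK // posrE ltr0n.
Qed.

Lemma npowD1 (R : realType) (d t : R) (n : nat) : (0 < n)%N ->
  npow (1 + d) t n = (n%:R^-1)%:C * npow d t n.
Proof. by move=> n0; rewrite /npow rpowD1 // rmorphM mulrA. Qed.

Lemma rpow_anti (R : realType) (d : R) (m n : nat) : 0 <= d -> (0 < m)%N ->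
  (m <= n)%N -> rpow d n <= rpow d m.
Proof.
move=> d0 m0 mn; rewrite /rpow ler_expR lerN2 ler_wpM2l //.
by rewrite ler_ln ?posrE ?ltr0n ?ler_nat // (leq_trans m0).
Qed.

Lemma rpow_le1 (R : realType) (d : R) (n : nat) : 0 <= d -> (0 < n)%N ->
  rpow d n <= 1.
Proof.
move=> d0 n0; apply: le_trans (rpow_anti d0 (ltn0Sn 0) n0) _.
by rewrite /rpow ln1 mulr0 oppr0 expR0.
Qed.

Lemma rpow_cvg0 (R : realType) (d e : R) : 0 < d -> 0 < e ->
  exists Y0, forall Y, (Y0 <= Y)%N -> rpow d Y <= e.
Proof.
move=> d0 e0; exists (Num.bound (expR (- ln e / d))) => Y hY.
have hx : expR (- ln e / d) <= Y%:R.
  apply: ltW; apply: lt_le_trans (archi_boundP (expR_ge0 _)) _.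
  by rewrite ler_nat.
have Y0 : 0 < Y%:R :> R by apply: lt_le_trans hx; exact: expR_gt0.
rewrite /rpow -[leRHS]lnK ?posrE // ler_expR lerNl -ler_pdivrMl //.
by rewrite mulrC -[leLHS]expRK ler_ln ?posrE ?expR_gt0.
Qed.

(** The integral comparison for n^{-(1+d)}, in telescoped form: each term is
    at most d^{-1} ((n-1)^{-d} - n^{-d}), because e^x >= 1 + x. *)
Lemma rpow_tail (R : realType) (d : R) (Y X : nat) : 0 < d -> (0 < Y)%N ->
  \sum_(Y.+1 <= n < X.+1) rpow (1 + d) n <= d^-1 * rpow d Y.
Proof.
move=> d0 Y0.
have step n : (0 < n)%N -> rpow (1 + d) n.+1 <= d^-1 * (rpow d n - rpow d n.+1).
  move=> n0; rewrite ler_pdivlMl // rpowD1 //.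
  have n0R : 0 < n%:R :> R by rewrite ltr0n.
  have nSR : n%:R <= n.+1%:R :> R by rewrite ler_nat.
  have /andP[lnb _] := ln_sub_bounds n0R nSR.
  have e1 : n.+1%:R - n%:R = 1 :> R by rewrite -natrB // subSnn.
  rewrite e1 div1r in lnb.
  have -> : rpow d n = rpow d n.+1 * expR (d * (ln n.+1%:R - ln n%:R)).
    by rewrite /rpow -expRD; congr expR; ring.
  rewrite -[X in _ <= _ - X]mulr1 -mulrBr mulrA mulrC ler_pM2l ?rpow_gt0 //.
  rewrite lerBrDl; apply: le_trans (expR_ge1Dx _).
  by rewrite lerD2l ler_pM2l.
case: (leqP Y X) => [YX|XY]; last first.
  by rewrite big_geq ?ltnS 1?ltnW // mulr_ge0 ?invr_ge0 ?ltW ?rpow_gt0.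
apply: (@le_trans _ _ (d^-1 * (rpow d Y - rpow d X))); last first.
  by rewrite ler_pM2l ?invr_gt0 // lerBlDr lerDl ltW ?rpow_gt0.
elim: X YX => [|X IH]; first by rewrite leqn0 => /eqP Y00; rewrite Y00 in Y0.
rewrite leq_eqVlt => /orP[/eqP <-|YX].
  by rewrite big_geq // subrr mulr0.
rewrite big_nat_recr //=.
apply: le_trans (lerD (IH YX) (step X _)) _; first exact: leq_trans Y0 YX.
by rewrite -mulrDr addrA subrK.
Qed.

(** * The Euler product, obtained by sieving one prime at a time *)

Lemma sum_multiples (V : nmodType) (p X : nat) (F : nat -> V) : (0 < p)%N ->
  \sum_(1 <= n < X.+1 | (p %| n)%N) F n =
  \sum_(1 <= m < (X %/ p).+1) F (p * m)%N.
Proof.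
move=> p0; elim: X => [|X IH]; first by rewrite div0n !big_geq.
rewrite big_mkcond big_nat_recr //= -big_mkcond IH divnS //.
case: (boolP (p %| X.+1)%N) => [pX|_]; last by rewrite addr0.
rewrite /= add1n [RHS]big_nat_recr //=; congr (_ + F _).
have := divnS X p0; rewrite pX add1n => <-.
by rewrite mulnC divnK.
Qed.

(** Coprimality with Y! selects the n all of whose prime factors exceed Y. *)
Definition rough_sum (V : nmodType) (a : nat -> V) (Y X : nat) : V :=
  \sum_(1 <= n < X.+1 | coprime n Y`!) a n.

Lemma coprime_factS (Y n : nat) :
  coprime n (Y.+1)`! = coprime n Y.+1 && coprime n Y`!.
Proof. by rewrite factS coprimeMr. Qed.

(** Passing from Y to Y+1 removes new integers only when Y+1 is prime, so
    the sieve can run over all Y. *)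
Lemma coprime_fact_comp (Y n : nat) : ~~ prime Y.+1 ->
  coprime n (Y.+1)`! = coprime n Y`!.
Proof.
rewrite coprime_factS => nprim; apply/andP/idP => [[]//|cop]; split=> //.
case: (posnP Y) => [->|Y0]; first by rewrite coprimen1.
have /primePn[|[d /andP[d1 dY] dvd]] := nprim; first by rewrite ltnS ltnNge Y0.
case/dvdnP: dvd => e eqY.
have dvdf c : (0 < c <= Y)%N -> coprime n c.
  by move=> cY; apply: coprime_dvdr cop; rewrite dvdn_fact.
rewrite eqY coprimeMr !dvdf //; first by rewrite (ltnW d1).
nia.
Qed.

Lemma coprime_fact_gt (Y n : nat) : (1 < n <= Y)%N -> coprime n Y`! = false.
Proof.
move=> /andP[n1 nY]; apply/negP => /(coprime_dvdr (dvdn_fact _)) cop.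
have := cop n; rewrite (ltnW n1) nY => /(_ isT).
by rewrite /coprime gcdnn; case: n n1 {nY cop} => [|[]].
Qed.

Lemma prime_coprime_fact (p k : nat) : prime p -> (k < p)%N -> coprime p k`!.
Proof.
move=> pr; elim: k => [|k IH] kp; first by rewrite coprimen1.
by rewrite factS coprimeMr IH ?(ltnW kp) // prime_coprime // gtnNdvd.
Qed.

(** The multiples of the prime p = Y+1 among the Y-rough n are the p m with m
    Y-rough; on them the completely multiplicative a factors. *)
Lemma rough_sum_prime (R : realType) (a : nat -> R[i]) (Y X : nat) :
    (forall m n, (0 < m)%N -> (0 < n)%N -> a (m * n)%N = a m * a n) ->
    prime Y.+1 ->
  rough_sum a Y X =
  rough_sum a Y.+1 X + a Y.+1 * rough_sum a Y (X %/ Y.+1).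
Proof.
move=> aM pr; rewrite /rough_sum (bigID (fun n => Y.+1 %| n)%N) /= addrC.
congr (_ + _).
  by apply: eq_bigl => n; rewrite coprime_factS [coprime n Y.+1]coprime_sym
    (prime_coprime _ pr) andbC.
rewrite big_mkcondl /= sum_multiples // big_distrr /= [RHS]big_mkcond /=.
rewrite !big_nat; apply: eq_bigr => m /andP[m0 _].
rewrite coprimeMl (prime_coprime_fact pr) //=.
by case: ifP => // _; rewrite aM.
Qed.

(** Absolute convergence as a Cauchy condition: all complex sums then stay
    finite, and no limit in the complex plane has to be taken. *)
Definition abs_summable (R : realType) (a : nat -> R[i]) : Prop :=
  forall e : R, 0 < e -> exists X0 : nat, forall X1 X2, (X0 <= X1)%N ->
    \sum_(X1.+1 <= n < X2.+1) normc (a n) <= e.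

Lemma rough_sum_tail (R : realType) (a : nat -> R[i]) (Y X1 X2 : nat) :
  (X1 <= X2)%N ->
  normc (rough_sum a Y X2 - rough_sum a Y X1) <=
  \sum_(X1.+1 <= n < X2.+1) normc (a n).
Proof.
move=> X12; rewrite /rough_sum (@big_cat_nat _ _ _ X1.+1) //= addrAC subrr add0r.
apply: le_trans (normc_le_sum _ _ _) _.
rewrite big_mkcond; apply: ler_sum => n _; case: ifP => // _.
exact: normc_ge0.
Qed.

(** Multiplying the N-rough sum by 1 - a p removes the multiples of p, up to
    the terms between X/p and X, which vanish as X grows. *)
Lemma euler_sieve (R : realType) (a : nat -> R[i]) (N Y : nat) :
    (forall m n, (0 < m)%N -> (0 < n)%N -> a (m * n)%N = a m * a n) ->
    (forall n, (0 < n)%N -> normc (a n) <= 1) -> abs_summable a ->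
    (N <= Y)%N ->
  forall e : R, 0 < e -> exists X0 : nat, forall X, (X0 <= X)%N ->
    normc (\prod_(N.+1 <= p < Y.+1 | prime p) (1 - a p) * rough_sum a N X
           - rough_sum a Y X) <= e.
Proof.
move=> aM a1 asum; elim: Y => [|Y IH] NY e e0.
  move: NY; rewrite leqn0 => /eqP ->; exists 0%N => X _.
  by rewrite big_geq // mul1r subrr normc0 ltW.
case: (leqP N Y) => [{}NY|YN]; last first.
  have -> : N = Y.+1 by apply/eqP; rewrite eqn_leq NY.
  by exists 0%N => X _; rewrite big_geq // mul1r subrr normc0 ltW.
case: (boolP (prime Y.+1)) => [pr|npr]; last first.
  have [X0 hX0] := IH NY e e0; exists X0 => X hX.
  rewrite big_mkcond big_nat_recr ?ltnS //= (negbTE npr) mulr1 -big_mkcond.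
  suff -> : rough_sum a Y.+1 X = rough_sum a Y X by exact: hX0.
  by apply: eq_bigl => n; rewrite coprime_fact_comp.
have e4 : 0 < e / 4 by rewrite divr_gt0.
have [X0 hX0] := IH NY _ e4; have [X1 hX1] := asum _ e4.
exists (maxn X0 (X1 * Y.+1)) => X; rewrite geq_max => /andP[hX hX'].
rewrite big_mkcond big_nat_recr ?ltnS //= pr -big_mkcond.
have ap : normc (a Y.+1) <= 1 by exact: a1.
have := hX0 _ hX; have := rough_sum_prime X aM pr.
have hd : (X %/ Y.+1 <= X)%N by exact: leq_div.
have := le_trans (rough_sum_tail a Y hd) (hX1 _ X _).
rewrite leq_divRL // => /(_ hX').
set P := (\prod_(_ <= _ < _ | _) _); set S := rough_sum a N X.
set SY := rough_sum a Y X; set D := rough_sum a Y _; move=> hD eqS hP.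
have -> : P * (1 - a Y.+1) * S - rough_sum a Y.+1 X =
    (1 - a Y.+1) * (P * S - SY) - a Y.+1 * (SY - D).
  by rewrite [in LHS](_ : rough_sum _ _ _ = SY - a Y.+1 * D) ?eqS; ring.
apply: le_trans (le_normcD _ _) _; rewrite normcN !normcM.
have h1 : normc (1 - a Y.+1) <= 2.
  apply: le_trans (le_normcD _ _) _; rewrite normcN normc1; lra.
have := normc_ge0 (P * S - SY); have := normc_ge0 (SY - D).
have := normc_ge0 (1 - a Y.+1); have := normc_ge0 (a Y.+1).
nra.
Qed.

(** The Euler product, read as the end of the sieve: once every prime up to Y
    has been removed only n = 1 and a tail of the series remain. *)
Lemma euler_product (R : realType) (a : nat -> R[i]) (N : nat) :
    (forall m n, (0 < m)%N -> (0 < n)%N -> a (m * n)%N = a m * a n) ->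
    (forall n, (0 < n)%N -> normc (a n) <= 1) -> abs_summable a -> a 1%N = 1 ->
  forall e : R, 0 < e -> exists Y0 : nat, forall Y, (Y0 <= Y)%N ->
    exists X0 : nat, forall X, (X0 <= X)%N ->
    normc (\prod_(N.+1 <= p < Y.+1 | prime p) (1 - a p) * rough_sum a N X - 1)
      <= e.
Proof.
move=> aM a1 asum a11 e e0.
have e2 : 0 < e / 2 by rewrite divr_gt0.
have [Z hZ] := asum _ e2.
exists (maxn 1 (maxn N Z)) => Y; rewrite !geq_max => /and3P[Y0 NY ZY].
have [X0 hX0] := euler_sieve aM a1 asum NY e2.
exists (maxn Y X0) => X; rewrite geq_max => /andP[YX hX].
have := hX0 _ hX.
set P := _ * _ => hP.
have -> : P - 1 = (P - rough_sum a Y X) + (rough_sum a Y X - 1) by ring.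
apply: le_trans (le_normcD _ _) _.
rewrite [leRHS](splitr e) lerD //.
have <- : rough_sum a Y Y = 1.
  rewrite /rough_sum big_ltn_cond ?ltnS // coprime1n big_nat_cond big_pred0 ?addr0 //.
  move=> n; apply/negP => /andP[/andP[n1 nY]].
  by rewrite coprime_fact_gt ?n1.
by apply: le_trans (rough_sum_tail a Y YX) _; exact: hZ.
Qed.

(** * Comparing the Euler products of n^{-(1+d)} and n^{-(1+d+it)} *)

Lemma normc_le (R : rcfType) (x y b : R) : 0 <= b ->
  x ^+ 2 + y ^+ 2 <= b ^+ 2 -> normc (x +i* y) <= b.
Proof.
move=> b0 h; rewrite /= -(ger0_norm b0) -sqrtr_sqr.
by rewrite ler_sqrt // sqr_ge0.
Qed.

(** Follows from |1 - r e^{ix}|^2 = (1-r)^2 + 2r(1 - cos x) and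
    1 + 8y <= (1 + 4y)^2 <= e^{8y}; the bound r <= 1/2 makes (1-r)^2 at
    least 1/4. *)
Lemma normc_euler_factor (R : realType) (r x : R) : 0 <= r -> r <= 1 / 2 ->
  normc (1 - r%:C * (cos x +i* sin x)) <= (1 - r) * expR (4 * (r * (1 - cos x))).
Proof.
move=> r0 r2; have c1 := cos_le1 x; have sc := cos2Dsin2 x.
set b := r * (1 - cos x); have b0 : 0 <= b by rewrite mulr_ge0 // subr_ge0.
have -> : 1 - r%:C * (cos x +i* sin x) = (1 - r * cos x) +i* (- (r * sin x)).
  by simpc.
have e4 := expR_ge1Dx (4 * b).
apply: normc_le; first by rewrite mulr_ge0 ?expR_ge0 //; lra.
apply: (@le_trans _ _ ((1 - r) ^+ 2 + 2 * b)).
  have s2 : sin x ^+ 2 = 1 - cos x ^+ 2 by rewrite -sc; ring.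
  by rewrite sqrrN !exprMn s2 le_eqVlt; apply/orP; left; apply/eqP; rewrite /b; ring.
apply: (@le_trans _ _ ((1 - r) ^+ 2 * (1 + 4 * b) ^+ 2)).
  have h : 1 / 4 <= (1 - r) ^+ 2 by nra.
  have : (1 + 8 * b) <= (1 + 4 * b) ^+ 2 by nra.
  nra.
rewrite exprMn ler_wpM2l ?sqr_ge0 //.
by rewrite ler_pXn2r // nnegrE ?expR_ge0 //; lra.
Qed.

Lemma rpowD1_le_half (R : realType) (d : R) (n : nat) : 0 <= d -> (1 < n)%N ->
  rpow (1 + d) n <= 1 / 2.
Proof.
move=> d0 n1; have n0 := ltnW n1; rewrite rpowD1 //.
have h1 := rpow_le1 d0 n0; have h0 := rpow_gt0 d n.
have h2 : n%:R^-1 <= 2^-1 :> R by rewrite lef_pV2 ?posrE ?ltr0n // ler_nat.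
have h3 : 0 <= n%:R^-1 :> R by rewrite invr_ge0.
nra.
Qed.

Lemma euler_products_cmp (R : realType) (d t : R) (N Y : nat) : 0 <= d ->
  normc (\prod_(N.+1 <= p < Y.+1 | prime p) (1 - npow (1 + d) t p)) <=
  expR (4 * \sum_(N.+1 <= p < Y.+1 | prime p)
              rpow (1 + d) p * (1 - cos (t * ln p%:R))) *
  \prod_(N.+1 <= p < Y.+1 | prime p) (1 - rpow (1 + d) p).
Proof.
move=> d0.
have factor p : prime p -> normc (1 - npow (1 + d) t p) <=
    expR (4 * (rpow (1 + d) p * (1 - cos (t * ln p%:R)))) * (1 - rpow (1 + d) p).
  move=> pr; rewrite [leRHS]mulrC.
  have -> : cos (t * ln p%:R) = cos (- t * ln p%:R) by rewrite mulNr cosN.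
  apply: normc_euler_factor; first exact/ltW/rpow_gt0.
  by rewrite rpowD1_le_half // prime_gt1.
rewrite normc_prod mulr_sumr (big_morph _ (@expRD R) (@expR0 R)) -big_split.
apply: ler_prod => p pr; apply/andP; split; first exact: normc_ge0.
exact: factor.
Qed.

Lemma npow_abs_summable (R : realType) (d t : R) : 0 < d ->
  abs_summable (npow (1 + d) t).
Proof.
move=> d0 e e0; have de0 : 0 < d * e by rewrite mulr_gt0.
have [Y0 hY] := rpow_cvg0 d0 de0; exists Y0.+1 => X1 X2 hX.
under eq_bigr do rewrite normc_npow.
apply: le_trans (rpow_tail _ d0 _) _; first exact: leq_trans hX.
by rewrite ler_pdivrMl // hY // ltnW.
Qed.

(** If p^{it} is close to 1 for most primes p > N, the two Euler products have
    comparable moduli, hence so do the two Dirichlet series: the positive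
    series cannot exceed a bound C for the oscillating one by more than the
    factor e^{4Q}. *)
Lemma rough_sum_le_expR (R : realType) (d t C Q : R) (N X1 : nat) :
    0 < d ->
    (forall Y, \sum_(N.+1 <= p < Y.+1 | prime p)
                 rpow (1 + d) p * (1 - cos (t * ln p%:R)) <= Q) ->
    (forall X, (X1 <= X)%N -> normc (rough_sum (npow (1 + d) t) N X) <= C) ->
  rough_sum (rpow (1 + d)) N X1 <= expR (4 * Q) * C.
Proof.
move=> d0 hQ hC.
have nM t' m n : (0 < m)%N -> (0 < n)%N ->
    npow (1 + d) t' (m * n)%N = npow (1 + d) t' m * npow (1 + d) t' n.
  exact: npowM.
have n1 t' n : (0 < n)%N -> normc (npow (1 + d) t' n) <= 1.
  by move=> n0; rewrite normc_npow rpow_le1 // addr_ge0 // ltW.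
have n11 t' : npow (1 + d) t' 1 = 1.
  by rewrite /npow /npowi /rpow ln1 !mulr0 oppr0 expR0 cos0 sin0 mulr1.
have summ t' := npow_abs_summable t' d0.
have C0 : 0 <= C by apply: le_trans (normc_ge0 _) (hC X1 (leqnn _)).
set S1 := rough_sum _ N X1; set K := expR (4 * Q) * C.
have K0 : 0 <= K by rewrite mulr_ge0 ?expR_ge0.
(* e bounds the error in both Euler products; it tends to 0. *)
suff key e : 0 < e -> (1 - e) * S1 <= K * (1 + e).
  case: (leP S1 K) => // SK.
  have sk : 0 < S1 + K by lra.
  have := key ((S1 - K) / (2 * (S1 + K))).
  have e0 : 0 < (S1 - K) / (2 * (S1 + K)) by rewrite divr_gt0 // ?subr_gt0 ?mulr_gt0.
  move=> /(_ e0); set e := _ / _ in e0 *.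
  have : e * (S1 + K) = (S1 - K) / 2 by rewrite /e; field; rewrite gt_eqF.
  nra.
move=> e0.
have [Y1 hY1] := euler_product N (nM t) (n1 t) (summ t) (n11 t) e0.
have [Y2 hY2] := euler_product N (nM 0) (n1 0) (summ 0) (n11 0) e0.
have [Z1 hZ1] := hY1 (maxn Y1 Y2) (leq_maxl _ _).
have [Z2 hZ2] := hY2 (maxn Y1 Y2) (leq_maxr _ _).
set Y := maxn Y1 Y2 in hZ1 hZ2.
set X := maxn X1 (maxn Z1 Z2).
have X1X : (X1 <= X)%N by rewrite leq_maxl.
have {hZ1} := hZ1 X; rewrite !leq_max leqnn !orbT => /(_ isT).
have {hZ2} := hZ2 X; rewrite !leq_max leqnn !orbT => /(_ isT).
have hC' := hC X X1X; have cmp := euler_products_cmp t N Y (ltW d0).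
have {}hQ := hQ Y.
set Pt := \prod_(_ <= _ < _ | _) _ in cmp *.
set Pi := \prod_(_ <= _ < _ | _) (1 - rpow _ _) in cmp.
have -> : \prod_(N.+1 <= p < Y.+1 | prime p) (1 - npow (1 + d) 0 p) = Pi%:C.
  rewrite rmorph_prod; apply: eq_bigr => p _.
  by rewrite npow0 rmorphB rmorph1.
have -> : rough_sum (npow (1 + d) 0) N X = (rough_sum (rpow (1 + d)) N X)%:C.
  by rewrite /rough_sum raddf_sum; apply: eq_bigr => n _; rewrite npow0.
rewrite -rmorphM -(rmorph1 (real_complex R)) -rmorphB normc_real rmorph1.
move=> h2 h1.
have S1X : S1 <= rough_sum (rpow (1 + d)) N X.
  rewrite /S1 /rough_sum (@big_cat_nat _ _ _ X1.+1 1 X.+1) //= lerDl.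
  by apply: sumr_ge0 => n _; exact/ltW/rpow_gt0.
have Pi0 : 0 <= Pi.
  rewrite /Pi big_seq_cond; apply: prodr_ge0 => p /andP[_ pr].
  have := rpowD1_le_half (ltW d0) (prime_gt1 pr); lra.
have S10 : 0 <= S1 by apply: sumr_ge0 => n _; exact/ltW/rpow_gt0.
have hPS : Pi * S1 <= 1 + e.
  apply: le_trans (ler_wpM2l Pi0 S1X) _.
  have := le_trans (ler_norm _) h2; lra.
have hlow : 1 - e <= normc Pt * C.
  apply: (@le_trans _ _ (normc (Pt * rough_sum (npow (1 + d) t) N X))).
    have := le_normcD (1 - Pt * rough_sum (npow (1 + d) t) N X)
      (Pt * rough_sum (npow (1 + d) t) N X).
    by rewrite subrK normc1 normcB; lra.
  by rewrite normcM ler_wpM2l // normc_ge0.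
apply: le_trans (ler_wpM2r S10 hlow) _.
apply: (@le_trans _ _ (expR (4 * Q) * Pi * C * S1)).
  rewrite !ler_wpM2r //; apply: le_trans cmp _.
  by rewrite ler_wpM2r // ler_expR ler_pM2l.
rewrite /K; have -> : expR (4 * Q) * Pi * C * S1 = (expR (4 * Q) * C) * (Pi * S1) by ring.
by rewrite ler_wpM2l.
Qed.

(** * Cancellation in sums of n^{-(1+d+it)} *)

Lemma sin_mvt (R : realType) (x : R) : 0 < x ->
  exists2 c : R, 0 < c < x & sin x = cos c * x.
Proof.
move=> x0.
have [|c] := @MVT R sin cos 0 x x0 (fun y _ => is_derive_sin y).
  exact/continuous_subspaceT/continuous_sin.
by rewrite in_itv /= sin0 !subr0 => cx eq; exists c.
Qed.

Lemma sin_norm_le (R : realType) (x : R) : `|sin x| <= `|x|.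
Proof.
wlog x0 : x / 0 < x.
  move=> h; case: (ltgtP 0 x) => [x0|x0|<-].
  - exact: h.
  - by rewrite -normrN -sinN -[leRHS]normrN; apply: h; rewrite oppr_gt0.
  - by rewrite sin0 normr0.
have [c _ ->] := sin_mvt x0.
by rewrite normrM ler_piMl // cos_max.
Qed.

Lemma cos_ge_sqr (R : realType) (x : R) : 1 - x ^+ 2 / 2 <= cos x.
Proof.
have -> : cos x = 1 - 2 * sin (x / 2) ^+ 2.
  have {1}-> : x = (x / 2) *+ 2 by rewrite -mulr_natr; field.
  by rewrite cos_mulr2n; have := cos2Dsin2 (x / 2); lra.
have := sin_norm_le (x / 2); rewrite -ler_sqr ?nnegrE // !real_normK ?num_real //.
rewrite exprMn; lra.
Qed.

Lemma sin_sub_le (R : realType) (x : R) : `|x - sin x| <= x ^+ 2.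
Proof.
wlog x0 : x / 0 < x.
  move=> h; case: (ltgtP 0 x) => [x0|x0|<-]; first exact: h.
  - by have := h (- x); rewrite oppr_gt0 sinN -opprD normrN sqrrN; exact.
  - by rewrite sin0 subrr normr0 expr0n.
have [c /andP[c0 cx] ->] := sin_mvt x0.
have -> : x - cos c * x = (1 - cos c) * x by ring.
have c1 := cos_le1 c; have cN1 := cos_geN1 c; have cs := cos_ge_sqr c.
rewrite ger0_norm ?mulr_ge0 ?subr_ge0 //; last exact: ltW.
rewrite expr2 ler_pM2r //; nra.
Qed.

Lemma expRN_le (R : realType) (x : R) : 0 <= x -> 1 - x <= expR (- x) <= 1 - x + x ^+ 2.
Proof.
move=> x0; rewrite expR_ge1Dx /=.
have h := expR_ge1Dx x.
rewrite expRN; apply: (@le_trans _ _ (1 + x)^-1).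
  by rewrite lef_pV2 ?posrE ?expR_gt0 //; lra.
rewrite -div1r ler_pdivrMr; nra.
Qed.

Lemma normc_le_add (R : rcfType) (x y : R) : normc (x +i* y) <= `|x| + `|y|.
Proof.
apply: normc_le; first by rewrite addr_ge0.
rewrite sqrrD !real_normK ?num_real //.
have : 0 <= `|x| * `|y| by rewrite mulr_ge0.
lra.
Qed.

(** The second order remainder of e^{-x+iy}.  It is bounded for every x >= 0
    and every y, so that the two variables need not be small. *)
Lemma exp_taylor (R : realType) (x y : R) : 0 <= x ->
  normc ((expR (- x))%:C * (cos y +i* sin y) - ((1 - x) +i* y))
    <= 2 * (x ^+ 2 + y ^+ 2).
Proof.
move=> x0; have /andP[e1 e2] := expRN_le x0.
have -> : (expR (- x))%:C * (cos y +i* sin y) - ((1 - x) +i* y) =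
  (expR (- x) * cos y - 1 + x) +i* (expR (- x) * sin y - y).
  by simpc; congr (_ +i* _); ring.
apply: le_trans (normc_le_add _ _) _.
have E0 := expR_ge0 (- x); have E1 : expR (- x) <= 1 by rewrite -expR0 ler_expR oppr_le0.
have c1 := cos_le1 y; have cs := cos_ge_sqr y.
have hre : `|expR (- x) * cos y - 1 + x| <= x ^+ 2 + y ^+ 2 / 2.
  rewrite ler_norml; apply/andP; split; nra.
have him : `|expR (- x) * sin y - y| <= y ^+ 2 + (x ^+ 2 + y ^+ 2) / 2.
  have -> : expR (- x) * sin y - y = - ((y - sin y) + (1 - expR (- x)) * sin y) by ring.
  rewrite normrN; apply: le_trans (ler_normD _ _) _.
  apply: lerD; first exact: sin_sub_le.
  rewrite normrM ger0_norm ?subr_ge0 //.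
  apply: (@le_trans _ _ (x * `|y|)).
    by apply: ler_pM; rewrite ?subr_ge0 ?sin_norm_le //; lra.
  have : 0 <= (x - `|y|) ^+ 2 by apply: sqr_ge0.
  rewrite sqrrB real_normK ?num_real //; lra.
have := sqr_ge0 y; lra.
Qed.

(** A discrete derivative of n^{-(d+it)}; the error is of second order in the
    relative step P / n. *)
Lemma npow_shift (R : realType) (d t : R) (n P : nat) :
    0 <= d -> 1 <= d ^+ 2 + t ^+ 2 -> (0 < n)%N ->
  normc (npow d t (n + P) - npow d t n * (1 - (d +i* t) * (P%:R / n%:R)%:C))
    <= 3 * (d ^+ 2 + t ^+ 2) * (P%:R / n%:R) ^+ 2.
Proof.
move=> d0 M1 n0; set M := d ^+ 2 + t ^+ 2 in M1 *; set q := P%:R / n%:R : R.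
pose l : R := ln (n + P)%:R - ln n%:R.
have n0R : 0 < n%:R :> R by rewrite ltr0n.
have P0R : 0 <= P%:R :> R by [].
have nP : n%:R <= (n + P)%:R :> R by rewrite ler_nat leq_addr.
have q0 : 0 <= q by rewrite divr_ge0.
have /andP[l1 l2] := ln_sub_bounds n0R nP.
have eP : (n + P)%:R - n%:R = P%:R :> R by rewrite natrD addrC addKr.
rewrite eP -/l -/q in l1 l2.
have l0 : 0 <= l by apply: le_trans l1; rewrite divr_ge0.
have ql : q - l <= q ^+ 2.
  suff : q - P%:R / (n + P)%:R <= q ^+ 2 by lra.
  rewrite /q natrD.
  have -> : P%:R / n%:R - P%:R / (n%:R + P%:R) =
     P%:R ^+ 2 * (n%:R * (n%:R + P%:R))^-1 :> R.
    by field; rewrite !gt_eqF //= ltr_wpDr.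
  rewrite exprMn ler_wpM2l ?sqr_ge0 // exprVn lef_pV2 ?posrE ?exprn_gt0 ?mulr_gt0 //.
    by rewrite expr2 ler_pM2l // lerDl.
  by rewrite ltr_wpDr.
have -> : npow d t (n + P) = npow d t n *
    ((expR (- (d * l)))%:C * (cos (- (t * l)) +i* sin (- (t * l)))).
  rewrite /npow mulrACA -rmorphM; congr (_%:C * _).
    by rewrite /rpow -expRD; congr expR; rewrite /l; ring.
  rewrite /npowi; have -> : - t * ln (n + P)%:R = - t * ln n%:R + - (t * l).
    by rewrite /l; ring.
  by rewrite cosD sinD; simpc; congr (_ +i* _); rewrite addrC.
rewrite -mulrBr normcM normc_npow.
apply: (@le_trans _ _ (1 * (3 * M * q ^+ 2))); last by rewrite mul1r.
apply: ler_pM; rewrite ?normc_ge0 ?rpow_le1 //; first exact/ltW/rpow_gt0.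
have dl0 : 0 <= d * l by rewrite mulr_ge0.
set E := _ * (_ +i* _).
have -> : E - (1 - (d +i* t) * q%:C) =
   (E - ((1 - d * l) +i* (- (t * l)))) + (d +i* t) * (q - l)%:C.
  have -> : (1 - d * l) +i* (- (t * l)) = 1 - (d +i* t) * l%:C by simpc.
  by rewrite (rmorphB (real_complex R) q l); ring.
apply: le_trans (le_normcD _ _) _.
have h1 := exp_taylor (- (t * l)) dl0.
have h2 : normc ((d +i* t) * (q - l)%:C) <= M * q ^+ 2.
  rewrite normcM normc_real ger0_norm ?subr_ge0 //.
  apply: ler_pM; rewrite ?normc_ge0 ?subr_ge0 //.
  apply: normc_le; first by lra.
  by rewrite -/M; nra.
have h3 : l ^+ 2 <= q ^+ 2 by rewrite ler_sqr.
have : 2 * ((d * l) ^+ 2 + (- (t * l)) ^+ 2) <= 2 * M * q ^+ 2.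
  have : M * l ^+ 2 <= M * q ^+ 2 by rewrite ler_wpM2l //; lra.
  by rewrite sqrrN !exprMn /M; lra.
lra.
Qed.

Lemma sum_shift_telescope (V : zmodType) (F : nat -> V) (T X P : nat) :
    (T <= X)%N ->
  \sum_(T.+1 <= n < X.+1) (F n - F (n + P)%N) =
  \sum_(T.+1 <= n < (T + P).+1) F n - \sum_(X.+1 <= n < (X + P).+1) F n.
Proof.
move=> TX; rewrite sumrB.
have -> : \sum_(T.+1 <= n < X.+1) F (n + P)%N =
    \sum_((T + P).+1 <= n < (X + P).+1) F n.
  by rewrite -!addSn big_addn addnK.
have h1 : \sum_(T.+1 <= n < (X + P).+1) F n =
    \sum_(T.+1 <= n < X.+1) F n + \sum_(X.+1 <= n < (X + P).+1) F n.
  by rewrite -big_cat_nat //= ltnS leq_addr.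
have h2 : \sum_(T.+1 <= n < (X + P).+1) F n =
    \sum_(T.+1 <= n < (T + P).+1) F n + \sum_((T + P).+1 <= n < (X + P).+1) F n.
  by rewrite -big_cat_nat //= ltnS ?leq_addr // leq_add2r.
apply/eqP; rewrite subr_eq addrAC eq_sym subr_eq; apply/eqP.
by rewrite -h1 -h2.
Qed.

Lemma sum_inv_sqr_le (R : realType) (T X : nat) : (0 < T)%N ->
  \sum_(T.+1 <= n < X.+1) (n%:R ^- 2 : R) <= T%:R^-1.
Proof.
move=> T0; have := @rpow_tail R 1 T X ltr01 T0.
have rp n : (0 < n)%N -> rpow 1 n = n%:R^-1 :> R.
  by move=> n0; rewrite /rpow mul1r expRN lnK // posrE ltr0n.
rewrite invr1 mul1r rp //; apply: le_trans.
rewrite le_eqVlt; apply/orP; left; apply/eqP.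
apply: eq_big_nat => n /andP[n0 _]; have {}n0 : (0 < n)%N by apply: leq_ltn_trans n0.
by rewrite rpowD1 // rp // expr2 invfM.
Qed.

Lemma coprime_fact_shift (N n : nat) : coprime (n + N`!) N`! = coprime n N`!.
Proof. by rewrite /coprime gcdnC addnC gcdnDl gcdnC. Qed.

(** Beyond T >= |d+it| the terms n^{-(1+d+it)} are, up to a summable error,
    differences of n^{-(d+it)} with lag P = N!.  This lag preserves the
    condition of being coprime to N!, so the sum telescopes and is bounded
    independently of X, d and t. *)
Lemma oscillating_tail (R : realType) (d t : R) (N T X : nat) :
    0 <= d -> 1 <= d ^+ 2 + t ^+ 2 <= T%:R ^+ 2 -> (T <= X)%N ->
  normc (\sum_(T.+1 <= n < X.+1 | coprime n N`!) npow (1 + d) t n)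
    <= 2 + 3 * N`!%:R.
Proof.
move=> d0 /andP[M1 MT] TX; set P := N`!.
have T0 : (0 < T)%N.
  case: (posnP T) MT => // -> h.
  by have := le_trans M1 h; rewrite expr0n /= ler10.
pose M := normc (d +i* t).
have M2 : M ^+ 2 = d ^+ 2 + t ^+ 2 by rewrite sqr_sqrtr // addr_ge0 ?sqr_ge0.
have M0 : 0 <= M by exact: normc_ge0.
have {}M1' : 1 <= M by rewrite -(@ler_sqr R) ?nnegrE // expr1n M2.
have MT' : M <= T%:R by rewrite -(@ler_sqr R) ?nnegrE // M2.
have P1 : 1 <= P%:R :> R by rewrite ler1n fact_gt0.
pose F n := if coprime n P then npow d t n else 0.
pose G n := if coprime n P then npow (1 + d) t n else 0.
rewrite big_mkcond -/G.
have step n : (0 < n)%N ->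
   normc ((d +i* t) * P%:R%:C * G n - (F n - F (n + P)%N)) <=
   3 * M ^+ 2 * P%:R ^+ 2 * n%:R ^- 2.
  move=> n0; rewrite /F /G coprime_fact_shift; case: ifP => _; last first.
    by rewrite mulr0 subrr subr0 normc0 !mulr_ge0 ?sqr_ge0 // invr_ge0 sqr_ge0.
  have := npow_shift P d0 M1 n0; rewrite -M2 exprMn exprVn mulrA; apply: le_trans.
  rewrite le_eqVlt; apply/orP; left; apply/eqP; congr normc.
  by rewrite npowD1 // [in RHS]rmorphM; ring.
set S := \sum_(_ <= _ < _) _.
have hS : normc ((d +i* t) * P%:R%:C * S -
    \sum_(T.+1 <= n < X.+1) (F n - F (n + P)%N)) <=
    3 * M ^+ 2 * P%:R ^+ 2 * T%:R^-1.
  rewrite /S mulr_sumr -sumrB; apply: le_trans (normc_le_sum _ _ _) _.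
  apply: (@le_trans _ _ (\sum_(T.+1 <= n < X.+1) 3 * M ^+ 2 * P%:R ^+ 2 * n%:R ^- 2)).
    by apply: ler_sum_nat => n /andP[nT _]; apply: step; apply: leq_ltn_trans nT.
  rewrite -mulr_sumr ler_wpM2l ?sum_inv_sqr_le //.
  by rewrite !mulr_ge0 ?sqr_ge0.
have hF a : normc (\sum_(a.+1 <= n < (a + P).+1) F n) <= P%:R.
  apply: le_trans (normc_le_sum _ _ _) _.
  apply: (@le_trans _ _ (\sum_(a.+1 <= n < (a + P).+1) 1)).
    apply: ler_sum_nat => n /andP[na _]; have n0 : (0 < n)%N by apply: leq_ltn_trans na.
    by rewrite /F; case: ifP => _; rewrite ?normc0 // normc_npow rpow_le1.
  by rewrite big_const_nat iter_addr_0 subSS addKn.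
rewrite sum_shift_telescope // in hS.
have : normc ((d +i* t) * P%:R%:C * S) <= 2 * P%:R + 3 * M ^+ 2 * P%:R ^+ 2 * T%:R^-1.
  set A := \sum_(_ <= _ < (T + P).+1) _ in hS; set B := \sum_(X.+1 <= _ < _) _ in hS.
  have := le_normcD ((d +i* t) * P%:R%:C * S - (A - B)) (A - B).
  have := le_normcD A (- B); rewrite normcN subrK.
  have := hF T; have := hF X; rewrite -/A -/B; lra.
rewrite normcM normcM normc_real normr_nat -/M.
have TV : T%:R^-1 <= M^-1.
  by rewrite lef_pV2 ?posrE ?ltr0n //; lra.
have MM : M * M^-1 = 1 by rewrite divff // gt_eqF; lra.
have S0 := normc_ge0 S.
have h5 : 3 * M ^+ 2 * P%:R ^+ 2 * T%:R^-1 <= 3 * M * P%:R ^+ 2.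
  rewrite (_ : 3 * M * P%:R ^+ 2 = 3 * M ^+ 2 * P%:R ^+ 2 * M^-1).
    by rewrite ler_wpM2l // !mulr_ge0 ?sqr_ge0.
  rewrite (_ : 3 * M ^+ 2 * P%:R ^+ 2 * M^-1 = 3 * M * P%:R ^+ 2 * (M * M^-1)).
    by rewrite MM mulr1.
  by ring.
move=> h6.
have MP : 0 < M * P%:R by apply: mulr_gt0; lra.
rewrite -(ler_pM2l MP); apply: (le_trans h6).
have : 2 * P%:R <= 2 * (M * P%:R) by nra.
lra.
Qed.

(** * Harmonic sums over integers coprime to N! *)

(** The totient of N!, as a real number; the harmonic bounds from above and
    from below are both proportional to it. *)
Definition coprime_count (R : realType) (N : nat) : R :=
  \sum_(1 <= n < N`!.+1 | coprime n N`!) 1.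

Lemma coprime_fact_shiftM (N n j : nat) :
  coprime (n + j * N`!) N`! = coprime n N`!.
Proof. by rewrite /coprime gcdnC addnC gcdnMDl gcdnC. Qed.

Lemma coprime_count_block (R : realType) (N j : nat) :
  \sum_((j * N`!).+1 <= n < (j.+1 * N`!).+1 | coprime n N`!) 1
    = coprime_count R N.
Proof.
rewrite -add1n big_addn mulSn -addSn addnK.
by apply: eq_bigl => n; rewrite coprime_fact_shiftM.
Qed.

Lemma coprime_count_ge0 (R : realType) (N : nat) : 0 <= coprime_count R N.
Proof. exact: sumr_ge0. Qed.

Lemma coprime_count_ge1 (R : realType) (N : nat) : 1 <= coprime_count R N.
Proof.
rewrite /coprime_count big_ltn_cond ?ltnS ?fact_gt0 // coprime1n lerDl.
exact: sumr_ge0.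
Qed.

Lemma inv_sum_block_ge (R : realType) (N j : nat) :
  coprime_count R N / N`!%:R / j.+1%:R <=
  \sum_((j * N`!).+1 <= n < (j.+1 * N`!).+1 | coprime n N`!) n%:R^-1.
Proof.
have P0 := fact_gt0 N; rewrite -(coprime_count_block R N j) -mulrA mulr_suml.
rewrite [leLHS]big_nat_cond [leRHS]big_nat_cond.
apply: ler_sum => n /andP[/andP[nl nu] _].
rewrite mul1r -invfM -natrM lef_pV2 ?posrE ?ltr0n ?muln_gt0 ?P0 //.
  by rewrite ler_nat mulnC -ltnS.
exact: leq_ltn_trans nl.
Qed.

Lemma inv_sum_block_le (R : realType) (N j : nat) : (0 < j)%N ->
  \sum_((j * N`!).+1 <= n < (j.+1 * N`!).+1 | coprime n N`!) n%:R^-1 <=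
  coprime_count R N / N`!%:R / j%:R.
Proof.
move=> j0; have P0 := fact_gt0 N.
rewrite -(coprime_count_block R N j) -mulrA mulr_suml.
rewrite [leLHS]big_nat_cond [leRHS]big_nat_cond.
apply: ler_sum => n /andP[/andP[nl nu] _].
rewrite mul1r -invfM -natrM lef_pV2 ?posrE ?ltr0n ?muln_gt0 ?P0 //.
  by rewrite ler_nat mulnC ltnW.
exact: leq_ltn_trans nl.
Qed.

(** Up to a bounded term, the harmonic sum over integers coprime to P = N! is
    phi(P)/P times a logarithm.  This bound and inv_sum_blocks_ge have the same
    leading constant phi(P)/P, which is what makes their ratio independent of N. *)
Lemma rough_inv_sum_le (R : realType) (N J : nat) : (0 < J)%N ->
  rough_sum (fun n => n%:R^-1 : R) N (J * N`!) <=
  2 * coprime_count R N + coprime_count R N / N`!%:R * ln J%:R.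
Proof.
move=> J0; set phi := coprime_count R N.
have phi0 : 0 <= phi by exact: coprime_count_ge0.
have P1 : 1 <= N`!%:R :> R by rewrite ler1n fact_gt0.
have rho0 : 0 <= phi / N`!%:R by rewrite divr_ge0.
pose r j := rough_sum (fun n => n%:R^-1 : R) N (j * N`!).
have rS j : r j.+1 = r j +
    \sum_((j * N`!).+1 <= n < (j.+1 * N`!).+1 | coprime n N`!) n%:R^-1.
  by rewrite /r /rough_sum -big_cat_nat //= ltnS leq_mul2r leqnSn orbT.
have r1 : r 1%N <= phi.
  rewrite /r mul1n /rough_sum /phi /coprime_count.
  rewrite [leLHS]big_nat_cond [leRHS]big_nat_cond.
  apply: ler_sum => n /andP[/andP[n1 _] _].
  by rewrite invf_le1 ?ler1n ?ltr0n.
have key j : (0 < j)%N -> r j.+1 <= 2 * phi + phi / N`!%:R * ln j%:R.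
  elim: j => // -[|j] IH _.
    rewrite rS ln1 mulr0 addr0; have := inv_sum_block_le R N (ltn0Sn 0).
    rewrite -/phi divr1 => h.
    have h2 : phi / N`!%:R <= phi by rewrite ler_pdivrMr ?ltr0n ?fact_gt0 // ler_peMr.
    lra.
  rewrite rS; have := inv_sum_block_le R N (ltn0Sn j.+1); rewrite -/phi.
  have n0 : 0 < j.+1%:R :> R by rewrite ltr0n.
  have nS : j.+1%:R <= j.+2%:R :> R by rewrite ler_nat.
  have /andP[+ _] := ln_sub_bounds n0 nS.
  have -> : j.+2%:R - j.+1%:R = 1 :> R by rewrite -natrB // subSnn.
  rewrite div1r => h /le_trans h2.
  have h3 := ler_wpM2l rho0 h; have := IH isT.
  rewrite mulrBr in h3.
  have {h2} := h2 _ h3; set B := \sum_(_ <= _ < _ | _) _; lra.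
apply: le_trans (key J J0); rewrite -/(r J) rS lerDl.
by apply: sumr_ge0 => n _; rewrite invr_ge0.
Qed.

Lemma inv_sum_blocks_ge (R : realType) (N J1 J2 : nat) : (J1 <= J2)%N ->
  coprime_count R N / N`!%:R * (ln J2.+1%:R - ln J1.+1%:R) <=
  \sum_((J1 * N`!).+1 <= n < (J2 * N`!).+1 | coprime n N`!) n%:R^-1.
Proof.
move=> J12; set rho := _ / _.
have rho0 : 0 <= rho by rewrite divr_ge0 // coprime_count_ge0.
elim: J2 J12 => [|J2 IH].
  by rewrite leqn0 => /eqP ->; rewrite subrr mulr0 big_geq.
rewrite leq_eqVlt => /orP[/eqP <-|J12]; first by rewrite subrr mulr0 big_geq.
rewrite (@big_cat_nat _ _ _ (J2 * N`!).+1) /=; last 2 first.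
- by rewrite ltnS leq_mul2r -ltnS J12 orbT.
- by rewrite ltnS leq_mul2r leqnSn orbT.
apply: le_trans (lerD (IH J12) (inv_sum_block_ge R N J2)); rewrite -/rho.
have n0 : 0 < J2.+1%:R :> R by rewrite ltr0n.
have nS : J2.+1%:R <= J2.+2%:R :> R by rewrite ler_nat.
have /andP[_] := ln_sub_bounds n0 nS.
have -> : J2.+2%:R - J2.+1%:R = 1 :> R by rewrite -natrB // subSnn.
by rewrite div1r => h; rewrite -mulrDr ler_wpM2l // addrAC lerD2r -lerBlDl.
Qed.

(** * Upper bounds for sums over primes *)

Lemma fact_le_expn (n : nat) : (n`! <= n ^ n)%N.
Proof.
elim: n => // n IH; rewrite factS expnS leq_mul2l /=.
apply: leq_trans IH _; case: n => // n.
by rewrite leq_exp2r.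
Qed.

Lemma logn_fact_ge (p n : nat) : prime p -> (n %/ p <= logn p n`!)%N.
Proof.
move=> pr; rewrite logn_fact //; case: n => [|n]; first by rewrite div0n.
by rewrite big_ltn // expn1 leq_addr.
Qed.

Lemma ln_prod_expn (R : realType) (r : seq nat) (P : pred nat) (e : nat -> nat) :
  (forall p, P p -> (0 < p)%N) ->
  ln (\prod_(p <- r | P p) p ^ e p)%:R =
  \sum_(p <- r | P p) (e p)%:R * ln p%:R :> R.
Proof.
move=> P0.
suff [] : (0 < \prod_(p <- r | P p) p ^ e p)%N /\
  ln (\prod_(p <- r | P p) p ^ e p)%:R =
  \sum_(p <- r | P p) (e p)%:R * ln p%:R :> R by [].
elim/big_rec2: _ => [|p x y Pp [y0 IH]]; first by rewrite ln1.
have p0 : (0 < p ^ e p)%N by rewrite expn_gt0 P0.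
split; first by rewrite muln_gt0 p0.
by rewrite lnM_nat // IH natrX lnXn ?ltr0n ?P0 // mulr_natl.
Qed.

(** Chebyshev's argument: the exponent of p in y! is at least floor(y/p), and
    this is at least y/(2p) when p <= y; compare with ln y! <= y ln y. *)
Lemma sum_primes_ln_le (R : realType) (y : nat) : (0 < y)%N ->
  \sum_(1 <= p < y.+1 | prime p) (ln p%:R / p%:R : R) <= 2 * ln y%:R.
Proof.
move=> y0; have y0R : 0 < y%:R :> R by rewrite ltr0n.
have yf : (y <= y`!)%N by exact: fact_geq.
have lnf : ln (y`!%:R) <= y%:R * ln y%:R :> R.
  rewrite mulr_natl -lnXn // -natrX ler_ln ?posrE ?ltr0n ?fact_gt0 ?expn_gt0 ?y0 //.
  by rewrite ler_nat fact_le_expn.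
have decomp : ln (y`!%:R) = \sum_(1 <= p < y`!.+1) (logn p y`!)%:R * ln p%:R :> R.
  rewrite -{1}(partnT (fact_gt0 y)) /partn big_ltn //= mul1n.
  rewrite big_nat_cond ln_prod_expn; last by move=> p /andP[/andP[]].
  by rewrite -big_nat_cond.
have step : \sum_(1 <= p < y.+1 | prime p) y%:R / 2 * (ln p%:R / p%:R) <=
    ln y`!%:R :> R.
  rewrite decomp (@big_cat_nat _ _ _ y.+1 1 y`!.+1) //= -[leLHS]addr0.
  apply: lerD; last first.
    rewrite big_seq; apply: sumr_ge0 => p; rewrite mem_index_iota => /andP[py _].
    by rewrite mulr_ge0 // ln_ge0 // ler1n; apply: leq_ltn_trans py.
  rewrite big_mkcond; apply: ler_sum_nat => p /andP[p1 py].
  have lnp : 0 <= ln p%:R :> R by rewrite ln_ge0 // ler1n.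
  case: ifP => pr; last by rewrite mulr_ge0.
  have p0R : 0 < p%:R :> R by rewrite ltr0n.
  have hy : y%:R / 2 / p%:R <= (logn p y`!)%:R :> R.
    rewrite ler_pdivrMr // ler_pdivrMr // -!natrM ler_nat.
    have hl := logn_fact_ge y pr; have := divn_eq y p; have := ltn_pmod y p1.
    have : (0 < y %/ p)%N by rewrite divn_gt0.
    nia.
  have -> : y%:R / 2 * (ln p%:R / p%:R) = y%:R / 2 / p%:R * ln p%:R :> R by ring.
  exact: ler_wpM2r.
rewrite -mulr_sumr in step.
have := le_trans step lnf.
by rewrite -mulrA ler_pM2l // ler_pdivrMl // mulrC.
Qed.

(** Above y each 1/p is at most (ln p / p) / ln y. *)
Lemma sum_primes_inv_le (R : realType) (y : nat) : (1 < y)%N ->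
  \sum_(y.+1 <= p < (y ^ 2).+1 | prime p) (p%:R^-1 : R) <= 4.
Proof.
move=> y1; have y0 := ltnW y1.
have lny : 0 < ln y%:R :> R by rewrite ln_gt0 // ltr1n.
have y2 : (y <= y ^ 2)%N by rewrite expnS expn1 leq_pmulr.
have := sum_primes_ln_le R (_ : (0 < y ^ 2)%N); rewrite expn_gt0 y0 => /(_ isT).
rewrite (@big_cat_nat _ _ _ y.+1) //= natrX lnXn ?ltr0n // -[ln _ *+ 2]mulr_natl mulrA => h.
rewrite -(ler_pM2l lny) mulr_sumr.
have h0 : 0 <= \sum_(1 <= p < y.+1 | prime p) (ln p%:R / p%:R) :> R.
  rewrite big_nat_cond; apply: sumr_ge0 => p /andP[/andP[p1 _] _].
  by rewrite divr_ge0 // ln_ge0 // ler1n.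
apply: (@le_trans _ _ (\sum_(y.+1 <= p < (y ^ 2).+1 | prime p) (ln p%:R / p%:R))).
  rewrite [leLHS]big_nat_cond [leRHS]big_nat_cond.
  apply: ler_sum => p /andP[/andP[py _] _]; rewrite ler_wpM2r ?invr_ge0 //.
  by rewrite ler_ln ?posrE ?ltr0n ?ler_nat ?(ltnW py) // (leq_trans _ py).
lra.
Qed.

(** Cut the primes above y at y^2, y^4, y^8 and so on.  On each piece the sum
    of 1/p is at most 4, while the bound for the weight p^{-d} is squared from
    one piece to the next; hence the geometric series. *)
Lemma sum_primes_rpow_le (R : realType) (d : R) (y Y : nat) :
    0 <= d -> (1 < y)%N -> rpow d y <= 1 / 2 ->
  \sum_(y.+1 <= p < Y.+1 | prime p) rpow (1 + d) p <= 8 * rpow d y.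
Proof.
move=> d0.
suff dyadic J : forall y, (1 < y)%N -> rpow d y <= 1 / 2 ->
    \sum_(y.+1 <= p < (y ^ (2 ^ J)).+1 | prime p) rpow (1 + d) p <= 8 * rpow d y.
  move=> y1 q2; apply: le_trans (dyadic Y y y1 q2).
  have yY : (Y <= y ^ 2 ^ Y)%N.
    by apply: leq_trans (ltnW (ltn_expl _ y1)) (leq_pexp2l (ltnW y1) (ltnW (ltn_expl _ _))).
  case: (leqP Y y) => [Yy|yY'].
    by rewrite big_geq ?ltnS // sumr_ge0 // => p _; exact/ltW/rpow_gt0.
  rewrite (@big_cat_nat _ _ _ Y.+1 y.+1 (y ^ 2 ^ Y).+1) //= ?ltnS 1?ltnW // lerDl.
  by apply: sumr_ge0 => p _; exact/ltW/rpow_gt0.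
elim: J => [|J IH] {}y y1 q2.
  by rewrite expn0 expn1 big_geq // mulr_ge0 // ltW ?rpow_gt0.
have y0 := ltnW y1; have q0 := rpow_gt0 d y.
have qq : rpow d (y ^ 2) = rpow d y ^+ 2.
  rewrite /rpow natrX lnXn ?ltr0n // expr2 -expRD; congr expR.
  by rewrite mulr2n; ring.
have y2 : (y <= y ^ 2)%N by rewrite expnS expn1 leq_pmulr.
rewrite (@big_cat_nat _ _ _ (y ^ 2).+1) //=; last first.
  by rewrite ltnS leq_exp2l // expnS leq_pmulr // expn_gt0.
have h1 : \sum_(y.+1 <= p < (y ^ 2).+1 | prime p) rpow (1 + d) p <= 4 * rpow d y.
  apply: le_trans (ler_wpM2r (ltW q0) (sum_primes_inv_le R y1)).
  rewrite mulr_suml [leLHS]big_nat_cond [leRHS]big_nat_cond.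
  apply: ler_sum => p /andP[/andP[py _] _].
  have p0 : (0 < p)%N by apply: leq_ltn_trans py.
  by rewrite rpowD1 // ler_wpM2l ?invr_ge0 // rpow_anti // ltnW.
have h2 : \sum_((y ^ 2).+1 <= p < (y ^ 2 ^ J.+1).+1 | prime p) rpow (1 + d) p
    <= 8 * rpow d y ^+ 2.
  have -> : (y ^ 2 ^ J.+1 = (y ^ 2) ^ (2 ^ J))%N by rewrite -expnM -expnS.
  rewrite -qq; apply: IH; first exact: leq_trans y2.
  rewrite qq; nra.
nra.
Qed.

(** * The numbers p^{it} are not close to 1 *)

Lemma rough_sum_npow_le (R : realType) (d t : R) (N T X : nat) :
    0 <= d -> 1 <= d ^+ 2 + t ^+ 2 <= T%:R ^+ 2 -> (T <= X)%N ->
  normc (rough_sum (npow (1 + d) t) N X) <=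
  rough_sum (rpow (1 + d)) N T + (2 + 3 * N`!%:R).
Proof.
move=> d0 MT TX; rewrite /rough_sum (@big_cat_nat _ _ _ T.+1) //=.
apply: le_trans (le_normcD _ _) _; apply: lerD; last exact: oscillating_tail.
apply: le_trans (normc_le_sum _ _ _) _.
by apply: ler_sum => n _; rewrite normc_npow.
Qed.

Lemma rough_sum_rpow_le_inv (R : realType) (d : R) (N X : nat) : 0 <= d ->
  rough_sum (rpow (1 + d)) N X <= rough_sum (fun n => n%:R^-1) N X.
Proof.
move=> d0; rewrite /rough_sum [leLHS]big_nat_cond [leRHS]big_nat_cond.
apply: ler_sum => n /andP[/andP[n0 _] _].
by rewrite rpowD1 // ler_piMr ?invr_ge0 // rpow_le1.
Qed.

Lemma sum_nat_le_split (R : realType) (F : nat -> R) (P : pred nat)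
    (a b c : nat) : (forall n, P n -> 0 <= F n) ->
  \sum_(a <= n < c | P n) F n <=
  \sum_(a <= n < b | P n) F n + \sum_(b <= n < c | P n) F n.
Proof.
move=> F0; case: (leqP a b) => [ab|ba].
  case: (leqP b c) => [bc|cb]; first by rewrite -big_cat_nat.
  rewrite [X in _ + X]big_geq ?(ltnW cb) // addr0.
  case: (leqP a c) => [ac|ca]; last by rewrite big_geq ?(ltnW ca) // sumr_ge0.
  by rewrite (@big_cat_nat _ _ _ c a b) ?(ltnW cb) //= lerDl sumr_ge0.
rewrite [X in X + _]big_geq ?(ltnW ba) // add0r.
case: (leqP a c) => [ac|ca]; last by rewrite big_geq ?(ltnW ca) // sumr_ge0.
by rewrite (@big_cat_nat _ _ _ a b c) ?(ltnW ba) //= lerDr sumr_ge0.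
Qed.

Lemma rpowM (R : realType) (d : R) (m n : nat) : (0 < m)%N -> (0 < n)%N ->
  rpow d (m * n) = rpow d m * rpow d n.
Proof.
by move=> m0 n0; rewrite /rpow lnM_nat // mulrDr opprD expRD.
Qed.

Lemma rough_sum_growth (R : realType) (d : R) (N J1 J2 : nat) :
    0 <= d -> (0 < J1 <= J2)%N ->
  rough_sum (rpow (1 + d)) N (J1 * N`!) +
    rpow d (J2 * N`!) * (coprime_count R N / N`!%:R *
      (ln J2.+1%:R - ln J1.+1%:R)) <=
  rough_sum (rpow (1 + d)) N (J2 * N`!).
Proof.
move=> d0 /andP[J10 J12].
rewrite [leRHS]/rough_sum (@big_cat_nat _ _ _ (J1 * N`!).+1) //=; last first.
  by rewrite ltnS leq_mul2r J12 orbT.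
rewrite lerD2l.
apply: le_trans (ler_wpM2l (ltW (rpow_gt0 d _)) (inv_sum_blocks_ge R N J12)) _.
rewrite mulr_sumr [leLHS]big_nat_cond [leRHS]big_nat_cond.
apply: ler_sum => n /andP[/andP[nl nu] _].
have n0 : (0 < n)%N by apply: leq_ltn_trans nl.
by rewrite rpowD1 // mulrC ler_wpM2l ?invr_ge0 // rpow_anti.
Qed.

Lemma nat_sqrt (s : nat) : (0 < s)%N ->
  exists r, [/\ (0 < r)%N, (r * r <= s)%N & (s <= 4 * (r * r))%N].
Proof.
elim: s => // -[|s] IH _; first by exists 1%N.
have [r [r0 r1 r2]] := IH isT.
case: (leqP s.+2 (4 * (r * r))) => h; first by exists r; split=> //; apply: leqW.
exists (r.+1); split=> //; nia.
Qed.

(** The quantitative core.  With P = N!, cut the series at T = 2ksP and at rT,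
    where r is about the square root of s.  The part A of the positive series
    below T bounds the oscillating series up to 2 + 3P, by oscillating_tail.
    The part between T and rT is at least (phi(P)/P) (b^3/2) (ln r - ln 2),
    since (rT)^{-d} is the product of (2kP)^{-d} >= 1/2, s^{-d} = b^2 and
    r^{-d} >= b.  If the sum of (1 - cos(t ln p))/p over
    primes N < p <= s^2 is at most c, its weighted extension to all primes is
    at most c + 16 b^4 <= Q.  Then rough_sum_le_expR gives
    (1 - 4Q) S <= A + 2 + 3P for the series S up to rT, and dividing by
    phi(P)/P leaves an inequality between constants and multiples of ln s. *)
Lemma phase_deficit_ineq (R : realType) (b c Q d t : R) (N k s : nat) :
    0 < b -> b <= 1 / 2 -> 0 < d -> d <= 1 -> c + 16 * b ^+ 4 <= Q ->
    (0 < k)%N -> (1 < s)%N -> 1 <= `|t| <= (k * s)%:R ->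
    rpow d s = b ^+ 2 -> 1 / 2 <= rpow d (2 * k * N`!) ->
    \sum_(N.+1 <= p < (s ^ 2).+1 | prime p)
       p%:R^-1 * (1 - cos (t * ln p%:R)) <= c ->
  b ^+ 3 / 2 * (ln s%:R / 2 - 2 * ln 2) <=
  4 * Q * (2 * N`!%:R + ln (2 * k)%:R + 3 / 2 * ln s%:R)
   + (2 + 3 * N`!%:R) * N`!%:R.
Proof.
move=> b0 b1 d0 d1 hQ k0 s1 /andP[t1 t2] ds dk hc.
have s0 := ltnW s1; have P0 := fact_gt0 N.
set P : R := N`!%:R; have P1 : 1 <= P by rewrite /P ler1n.
have Q0 : 0 <= Q.
  apply: le_trans hQ; rewrite addr_ge0 // ?mulr_ge0 ?exprn_ge0 ?(ltW b0) //.
  apply: le_trans hc; apply: sumr_ge0 => p _.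
  by rewrite mulr_ge0 ?invr_ge0 // subr_ge0 cos_le1.
have term0 p : 0 <= rpow (1 + d) p * (1 - cos (t * ln p%:R)).
  by rewrite mulr_ge0 ?subr_ge0 ?cos_le1 // ltW ?rpow_gt0.
have ds2 : rpow d (s ^ 2) = b ^+ 4.
  by rewrite expnS expn1 rpowM // ds -exprD.
have hsum Y : \sum_(N.+1 <= p < Y.+1 | prime p)
    rpow (1 + d) p * (1 - cos (t * ln p%:R)) <= Q.
  apply: le_trans (sum_nat_le_split _ (s ^ 2).+1 _ _) _; first by move=> p _.
  apply: le_trans hQ; apply: lerD.
    apply: le_trans hc; rewrite [leLHS]big_nat_cond [leRHS]big_nat_cond.
    apply: ler_sum => p /andP[/andP[pN _] _].
    have p0 : (0 < p)%N by apply: leq_ltn_trans pN.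
    rewrite ler_wpM2r ?subr_ge0 ?cos_le1 // rpowD1 //.
    by rewrite ler_piMr ?invr_ge0 // rpow_le1 // ltW.
  apply: (@le_trans _ _ (2 * (8 * rpow d (s ^ 2)))); last by rewrite ds2; lra.
  have h4 : rpow d (s ^ 2) <= 1 / 2.
    have bb : b ^+ 2 <= 1 / 4 by rewrite expr2; nra.
    by rewrite ds2 (exprD b 2 2); have := sqr_ge0 b; nra.
  have s21 : (1 < s ^ 2)%N by rewrite -{1}(exp1n 2) ltn_exp2r.
  apply: (@le_trans _ _
      (2 * \sum_((s ^ 2).+1 <= p < Y.+1 | prime p) rpow (1 + d) p)); last first.
    by rewrite ler_pM2l // sum_primes_rpow_le // ltW.
  rewrite mulr_sumr; apply: ler_sum => p _; rewrite [leLHS]mulrC.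
  rewrite ler_wpM2r ?(ltW (rpow_gt0 _ _)) //.
  have := cos_geN1 (t * ln p%:R); lra.
(* J1 and J2 count blocks of length N!, so that both cuts fall at multiples
   of N!. *)
have [r [r0 r1 r2]] := nat_sqrt s0.
pose J1 := (2 * k * s)%N; pose J2 := (J1 * r)%N.
have J10 : (0 < J1)%N by rewrite !muln_gt0 k0 s0.
have J12 : (J1 <= J2)%N by rewrite leq_pmulr.
set A := rough_sum (rpow (1 + d)) N (J1 * N`!).
set S := rough_sum (rpow (1 + d)) N (J2 * N`!).
have hS : S <= expR (4 * Q) * (A + (2 + 3 * P)).
  apply: (rough_sum_le_expR d0 hsum) => X hX.
  apply: rough_sum_npow_le; first exact: ltW.
    have tt : t ^+ 2 = `|t| ^+ 2 by rewrite real_normK ?num_real.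
    have hJ : 2 * (k * s)%:R <= (J1 * N`!)%:R :> R.
      by rewrite -natrM ler_nat /J1 mulnA leq_pmulr.
    rewrite tt; apply/andP; split; first by nra.
    apply: (@le_trans _ _ ((2 * (k * s)%:R) ^+ 2)); last first.
      by rewrite ler_sqr // nnegrE.
    nra.
  by apply: leq_trans hX; rewrite leq_mul2r J12 orbT.
have A0 : 0 <= A by apply: sumr_ge0 => n _; exact/ltW/rpow_gt0.
have hS' : (1 - 4 * Q) * S <= A + (2 + 3 * P).
  have S0 : 0 <= S by apply: sumr_ge0 => n _; exact/ltW/rpow_gt0.
  apply: (@le_trans _ _ (expR (- (4 * Q)) * S)).
    by rewrite ler_wpM2r // expR_ge1Dx.
  rewrite -ler_pdivlMl ?expR_gt0 // -expRN opprK; exact: hS.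
set rho := coprime_count R N / P.
have phi1 := coprime_count_ge1 R N.
have rho0 : 0 < rho by rewrite divr_gt0 //; lra.
have rhoP : coprime_count R N = rho * P by rewrite /rho divfK // gt_eqF; lra.
have ln2 : 0 <= ln 2 :> R by rewrite ln_ge0 //; lra.
have lnr : ln s%:R / 2 - ln 2 <= ln r%:R :> R.
  have : ln s%:R <= ln (4 * (r * r))%:R :> R.
    by rewrite ler_ln ?posrE ?ltr0n ?ler_nat ?muln_gt0 ?r0.
  rewrite lnM_nat ?muln_gt0 ?r0 // lnM_nat //.
  have -> : ln 4%:R = 2 * ln 2 :> R.
    by rewrite (natrM R 2 2) lnM ?posrE //; ring.
  lra.
have lnr' : ln r%:R <= ln s%:R / 2 :> R.
  have : ln (r * r)%:R <= ln s%:R :> R.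
    by rewrite ler_ln ?posrE ?ltr0n ?ler_nat ?muln_gt0 ?r0.
  rewrite lnM_nat //; lra.
have lnJ : ln s%:R / 2 - 2 * ln 2 <= ln J2.+1%:R - ln J1.+1%:R :> R.
  have h1 : ln J1.+1%:R <= ln (2 * J1)%:R :> R.
    have hn : (J1.+1 <= 2 * J1)%N by rewrite mul2n -addnn -addn1 leq_add2l.
    by rewrite ler_ln ?posrE ?ltr0n ?ler_nat // (leq_trans _ hn).
  have h2 : ln J2%:R <= ln J2.+1%:R :> R.
    by rewrite ler_ln ?posrE ?ltr0n ?ler_nat // muln_gt0 J10.
  rewrite lnM_nat // in h1; rewrite {1}/J2 lnM_nat // in h2; lra.
have hq : b ^+ 3 / 2 <= rpow d (J2 * N`!).
  have -> : (J2 * N`! = 2 * k * N`! * (s * r))%N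
    by rewrite /J2 /J1 -(mulnA (2 * k)%N) mulnAC.
  rewrite rpowM ?muln_gt0 ?k0 ?s0 ?P0 // (rpowM d s0 r0) ds.
  have hr : b <= rpow d r.
    rewrite -ler_sqr ?nnegrE ?(ltW b0) ?(ltW (rpow_gt0 _ _)) //.
    by rewrite -ds expr2 -rpowM // rpow_anti ?muln_gt0 ?r0 // ltW.
  have h2 : b ^+ 3 <= b ^+ 2 * rpow d r.
    by rewrite exprSr ler_wpM2l // sqr_ge0.
  have h3 : 0 <= b ^+ 3 by rewrite exprn_ge0 // ltW.
  nra.
have hup : S <= 2 * coprime_count R N + rho * (ln (2 * k)%:R + 3 / 2 * ln s%:R).
  apply: le_trans (rough_sum_rpow_le_inv _ _ (ltW d0)) _.
  have J20 : (0 < J2)%N by rewrite muln_gt0 J10.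
  apply: le_trans (rough_inv_sum_le R N J20) _; rewrite -/P -/rho lerD2l.
  rewrite ler_pM2l // /J2 /J1 lnM_nat ?muln_gt0 ?k0 // lnM_nat ?muln_gt0 ?k0 //.
  lra.
have J12' : (0 < J1 <= J2)%N by rewrite J10.
have := rough_sum_growth N (ltW d0) J12'; rewrite -/A -/S -/P -/rho => hlow.
have b3 : 0 < b ^+ 3 by rewrite exprn_gt0.
set l := ln s%:R / 2 - 2 * ln 2 in lnJ *.
(* For small s the left-hand side is nonpositive. *)
case: (leP l 0) => [l0|l0].
  apply: (@le_trans _ _ 0); first by rewrite mulr_ge0_le0 //; lra.
  have lns : 0 <= ln s%:R :> R by rewrite ln_ge0 // ler1n.
  have lnk : 0 <= ln (2 * k)%:R :> R by rewrite ln_ge0 // ler1n muln_gt0 k0.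
  by rewrite addr_ge0 // !mulr_ge0 // !addr_ge0 // mulr_ge0 //; lra.
have hlow2 : A + b ^+ 3 / 2 * (rho * l) <= S.
  apply: le_trans hlow; rewrite lerD2l.
  apply: ler_pM => //; first by lra.
    by rewrite mulr_ge0 // ltW.
  by rewrite ler_wpM2l // ltW.
rewrite -(ler_pM2l rho0).
have h6 : 4 * Q * S <= 4 * Q * (2 * coprime_count R N + rho * (ln (2 * k)%:R + 3 / 2 * ln s%:R)).
  by rewrite ler_wpM2l // mulr_ge0.
have h7 : 2 + 3 * P <= rho * ((2 + 3 * P) * P).
  have -> : rho * ((2 + 3 * P) * P) = (2 + 3 * P) * coprime_count R N.
    by rewrite rhoP; ring.
  by rewrite ler_peMr //; lra.
rewrite rhoP in h6.
have : b ^+ 3 / 2 * (rho * l) <= 4 * Q * S + (2 + 3 * P) by lra.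
move=> h8.
have -> : rho * (b ^+ 3 / 2 * l) = b ^+ 3 / 2 * (rho * l) by ring.
apply: (le_trans h8); rewrite mulrDr; apply: lerD => //.
apply: (le_trans h6); rewrite le_eqVlt; apply/orP; left; apply/eqP; ring.
Qed.

(** The contribution gained between s and s^{3/2} has weight of order b^3,
    whereas the primes above s^2, about which nothing is known, cost only 16 b^4.
    A small enough b therefore makes phase_deficit_ineq false for large s.  The
    choice b = 1/2000 works with c = b^3/100 and Q = b^3/50, since then
    c + 16 b^4 <= Q and 6 Q < b^3/4.  Only the threshold S0 depends on N and k. *)
Lemma prime_oscillation (R : realType) (N k : nat) : (0 < k)%N ->
  exists S0 : nat, forall s, (S0 <= s)%N -> forall t : R,
    1 <= `|t| <= (k * s)%:R ->
  1 / 2000 ^+ 3 / 100 <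
  \sum_(N.+1 <= p < (s ^ 2).+1 | prime p) p%:R^-1 * (1 - cos (t * ln p%:R)).
Proof.
move=> k0; set b : R := 1 / 2000.
have b0 : 0 < b by rewrite /b; lra.
have b1 : b <= 1 / 2 by rewrite /b; lra.
have hQ : 1 / 2000 ^+ 3 / 100 + 16 * b ^+ 4 <= b ^+ 3 / 50.
  by rewrite /b !exprS expr0; lra.
clearbody b; have bb : b ^+ 2 < 1 by rewrite expr2; nra.
have b3 : 0 < b ^+ 3 by rewrite exprn_gt0.
set P : R := N`!%:R; have P1 : 1 <= P by rewrite ler1n fact_gt0.
(* With d = K / ln s the weight n^{-d} equals b^2 at n = s. *)
pose K := - ln (b ^+ 2).
have K0 : 0 < K by rewrite oppr_gt0 ln_lt0 // bb exprn_gt0.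
have ln2 : 0 < ln 2 :> R by rewrite ln_gt0 //; lra.
have lnk : 0 <= ln (2 * k)%:R :> R by rewrite ln_ge0 // ler1n muln_gt0 k0.
have lnq : 0 <= ln (2 * k * N`!)%:R :> R.
  by rewrite ln_ge0 // ler1n !muln_gt0 k0 fact_gt0.
pose W := b ^+ 3 * ln 2 + 8 / 100 * (b ^+ 3 * (2 * P + ln (2 * k)%:R))
          + (2 + 3 * P) * P.
have W0 : 0 < W.
  have w1 : 0 <= b ^+ 3 * ln 2 by rewrite mulr_ge0 // ltW.
  have w2 : 0 <= b ^+ 3 * (2 * P + ln (2 * k)%:R).
    by rewrite mulr_ge0 ?(ltW b3) //; lra.
  have w3 : 0 < (2 + 3 * P) * P by rewrite mulr_gt0 //; lra.
  by rewrite /W; lra.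
(* The four parts of M give d <= 1, the bound for (2kP)^{-d}, and the failure
   of the inequality of phase_deficit_ineq. *)
pose x1 := W / b ^+ 3; pose x2 := K * ln (2 * k * N`!)%:R / ln 2.
pose M := 1 + K + x2 + 10 * x1.
exists (Num.bound (expR M)) => s hs t ht; rewrite ltNge; apply/negP => hc.
have x20 : 0 <= x2.
  by rewrite divr_ge0 ?(ltW ln2) // mulr_ge0 // ltW.
have x10 : 0 < x1 by rewrite divr_gt0.
have sM : M <= ln s%:R.
  have eM : expR M <= s%:R.
    by apply: ltW; apply: lt_le_trans (archi_boundP (expR_ge0 _)) _; rewrite ler_nat.
  rewrite -[M]expRK ler_ln ?posrE ?expR_gt0 //.
  exact: lt_le_trans (expR_gt0 M) eM.
have l1 : 1 <= ln s%:R :> R by apply: le_trans sM; rewrite /M; lra.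
have l0 : 0 < ln s%:R :> R by lra.
have s1 : (1 < s)%N.
  rewrite ltnNge; apply/negP => s1; have := l0; apply/negP; rewrite -leNgt.
  by rewrite ln_le0 // lern1.
pose d := K / ln s%:R.
have d0 : 0 < d by rewrite divr_gt0.
have d1 : d <= 1.
  by rewrite ler_pdivrMr // mul1r; apply: le_trans sM; rewrite /M; lra.
have ds : rpow d s = b ^+ 2.
  rewrite /rpow /d divfK ?gt_eqF // /K opprK lnK // posrE exprn_gt0 //.
have dk : 1 / 2 <= rpow d (2 * k * N`!).
  rewrite /rpow -[leLHS]lnK ?posrE; last lra.
  rewrite ler_expR div1r lnV ?posrE; last lra.
  rewrite lerN2 /d mulrAC ler_pdivrMr // -ler_pdivrMl // mulrC.
  by rewrite -/x2; apply: le_trans sM; rewrite /M; lra.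
have := phase_deficit_ineq b0 b1 d0 d1 hQ k0 s1 ht ds dk hc.
rewrite -/P; set l := ln s%:R.
have hl : 10 * W <= b ^+ 3 * l.
  have : 10 * x1 <= l by apply: le_trans sM; rewrite /M; lra.
  by rewrite /x1 mulrA ler_pdivrMr // [l * _]mulrC.
move=> h; have : b ^+ 3 * l * (13 / 100) <= W.
  rewrite /W; lra.
lra.
Qed.

(** * From pretentiousness to small prime sums *)

Lemma prime_sum_tail (R : realType) (F : nat -> R) :
    (forall p, prime p -> 0 <= F p) ->
    (\sum_(0 <= p <oo | prime p) (F p)%:E < +oo)%E ->
  forall e : R, 0 < e -> exists N0 : nat, forall N Y, (N0 <= N)%N ->
    \sum_(N.+1 <= p < Y.+1 | prime p) F p <= e.
Proof.
move=> F0 fin e e0.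
pose u p := if prime p then F p else 0.
have u0 p : 0 <= u p by rewrite /u; case: ifP => // /F0.
have finu : (\sum_(0 <= p <oo) (u p)%:E < +oo)%E.
  rewrite eseries_mkcond in fin.
  by under eq_eseriesr do rewrite /u fun_if.
have cv := nnseries_is_cvg u0 finu.
have mono : {homo series u : n m / (n <= m)%N >-> n <= m}.
  move=> n m nm; rewrite /series /= (@big_cat_nat _ _ _ n 0 m) //= lerDl.
  exact: sumr_ge0.
have /cvgrPdist_lt /(_ e e0) [N0 _ hN0] := cv.
exists N0 => N Y hN.
rewrite big_mkcond -/(u _).
case: (leqP N Y) => NY; last by rewrite big_geq 1?ltnW // ltW.
have -> : \sum_(N.+1 <= p < Y.+1) u p = series u Y.+1 - series u N.+1.
  by rewrite /series /= (@big_cat_nat _ _ _ N.+1 0 Y.+1) //= addrAC subrr add0r.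
have := hN0 N.+1 (leq_trans hN (leqnSn N)) => /=.
have := nondecreasing_cvgn_le mono cv Y.+1.
move=> h1 /(le_lt_trans (ler_norm _)); lra.
Qed.

Lemma sqr_normcE (R : rcfType) (z : R[i]) :
  normc z ^+ 2 = complex.Re z ^+ 2 + complex.Im z ^+ 2.
Proof. by case: z => x y; rewrite sqr_sqrtr // addr_ge0 ?sqr_ge0. Qed.

Lemma normc_sub1_sqr (R : rcfType) (z : R[i]) : normc z = 1 ->
  normc (1 - z) ^+ 2 = 2 * (1 - complex.Re z).
Proof.
move=> z1; have := sqr_normcE z; rewrite z1 expr1n => e.
have -> : normc (1 - z) ^+ 2 =
    1 - 2 * complex.Re z + (complex.Re z ^+ 2 + complex.Im z ^+ 2).
  by rewrite sqr_normcE {z1 e}; case: z => x y; simpl complex.Re; simpl complex.Im; ring.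
by rewrite -e; ring.
Qed.

Lemma normcX (R : rcfType) (z : R[i]) (k : nat) : normc (z ^+ k) = normc z ^+ k.
Proof.
by elim: k => [|k IH]; rewrite ?expr0 ?normc1 // !exprS normcM IH.
Qed.

Lemma normc_sub1X (R : rcfType) (z : R[i]) (k : nat) : normc z = 1 ->
  normc (1 - z ^+ k) <= k%:R * normc (1 - z).
Proof.
move=> z1; elim: k => [|k IH]; first by rewrite expr0 subrr normc0 mul0r.
have -> : 1 - z ^+ k.+1 = (1 - z ^+ k) + z ^+ k * (1 - z) by rewrite exprSr; ring.
apply: le_trans (le_normcD _ _) _; rewrite normcM normcX z1 expr1n mul1r.
by rewrite -natr1 mulrDl mul1r lerD2r.
Qed.

(** For |z| = 1 one has |1 - z|^2 = 2(1 - Re z), and |1 - z^k| <= k |1 - z|. *)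
Lemma one_sub_ReX (R : rcfType) (z : R[i]) (k : nat) : normc z = 1 ->
  1 - complex.Re (z ^+ k) <= k%:R ^+ 2 * (1 - complex.Re z).
Proof.
move=> z1; have zk1 : normc (z ^+ k) = 1 by rewrite normcX z1 expr1n.
rewrite -(@ler_pM2l _ 2) // mulrCA -(normc_sub1_sqr z1) -(normc_sub1_sqr zk1).
rewrite -exprMn ler_sqr ?nnegrE ?mulr_ge0 ?normc_ge0 //.
exact: normc_sub1X.
Qed.

Lemma Re_le_normc (R : rcfType) (z : R[i]) : `|complex.Re z| <= normc z.
Proof.
rewrite -ler_sqr ?nnegrE ?normc_ge0 // sqr_normcE real_normK ?num_real //.
by rewrite lerDl sqr_ge0.
Qed.

Lemma normc_conj (R : rcfType) (z : R[i]) : normc (conjc z) = normc z.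
Proof. by case: z => x y; rewrite /= sqrrN. Qed.

Lemma ReB (R : rcfType) (x y : R[i]) :
  complex.Re (x - y) = complex.Re x - complex.Re y.
Proof. by case: x => ? ?; case: y. Qed.

Lemma npowi_conj (R : realType) (u : R) (n : nat) : conjc (npowi u n) = npowi (- u) n.
Proof. by rewrite /npowi /= mulNr cosN sinN. Qed.

Lemma npowiD (R : realType) (u v : R) (n : nat) :
  npowi (u + v) n = npowi u n * npowi v n.
Proof.
rewrite /npowi mulrDl cosD sinD; simpc.
by congr (_ +i* _); rewrite addrC.
Qed.

Lemma npowiX (R : realType) (u : R) (k n : nat) :
  npowi u n ^+ k = npowi (k%:R * u) n.
Proof.
elim: k => [|k IH]; first by rewrite expr0 /npowi !mul0r cos0 sin0.
by rewrite exprSr IH -npowiD -natr1 mulrDl mul1r.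
Qed.

(** Euler's theorem.  Raising to this power removes the character from the
    pretentious distance. *)
Lemma character_totient (R : realType) (q : nat) (chi : nat -> R[i]) (n : nat) :
  dirichlet_character q chi -> coprime n q -> chi n ^+ totient q = 1.
Proof.
move=> [q0 per mul nz] cop.
have chi1 : chi 1%N = 1.
  have n0 : chi 1%N != 0 by apply/nz; rewrite coprime1n.
  by apply: (mulfI n0); rewrite mulr1 -mul.
have chiX k : chi (n ^ k)%N = chi n ^+ k.
  by elim: k => [|k IH]; rewrite ?expn0 ?expr0 // expnS exprS mul IH.
by rewrite -chiX -chi1; apply: per; exact: cyclic.Euler_exp_totient.
Qed.

Lemma normc_root1 (R : rcfType) (z : R[i]) (k : nat) : (0 < k)%N ->
  z ^+ k = 1 -> normc z = 1.
Proof.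
move=> k0 zk; have := congr1 (@normc R) zk; rewrite normcX normc1 => /eqP.
by rewrite pexpr_eq1 ?normc_ge0 // => /eqP.
Qed.

Lemma normc_eq1 (R : rcfType) (z : R[i]) : `|z| = 1 -> normc z = 1.
Proof. by move=> h; exact: (congr1 (@complex.Re R) h). Qed.

(** If z is within dl of p^{iv}, the k-th power of p^{iv} conj(p^{iu} x) is
    p^{ik(v-u)}, since x^k = 1; its distance from 1 is controlled by one_sub_ReX. *)
Lemma one_sub_cos_le (R : realType) (u v dl : R) (k p : nat) (z x : R[i]) :
    (0 < k)%N -> x ^+ k = 1 -> normc (z - npowi v p) <= dl ->
  1 - cos (k%:R * (v - u) * ln p%:R) <=
  k%:R ^+ 2 * ((1 - complex.Re (z * conjc (npowi u p * x))) + dl).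
Proof.
move=> k0 xk hz; have x1 := normc_root1 k0 xk.
set g := conjc (npowi u p * x).
have g1 : normc g = 1 by rewrite normc_conj normcM normc_npowi x1 mulr1.
pose w := npowi v p * g.
have w1 : normc w = 1 by rewrite normcM normc_npowi g1 mulr1.
have -> : cos (k%:R * (v - u) * ln p%:R) = complex.Re (w ^+ k).
  have conjM (a b : R[i]) : conjc (a * b) = conjc a * conjc b by exact: rmorphM.
  have conjX (a : R[i]) : conjc a ^+ k = conjc (a ^+ k) by rewrite -rmorphXn.
  rewrite /w /g conjM mulrA npowi_conj -npowiD exprMn npowiX conjX xk.
  by rewrite (rmorph1 (@conjc R)) mulr1.
apply: le_trans (one_sub_ReX k w1) _; rewrite ler_wpM2l ?sqr_ge0 //.
have h : normc (z * g - w) <= dl by rewrite -mulrBl normcM g1 mulr1.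
by have := le_trans (ler_norm _) (le_trans (Re_le_normc _) h); rewrite ReB; lra.
Qed.

Lemma pretends_sum_tail (R : realType) (f g : nat -> R[i]) :
    (forall p, prime p -> normc (f p) <= 1) ->
    (forall p, prime p -> normc (g p) <= 1) -> pretends f g ->
  forall e : R, 0 < e -> exists N0 : nat, forall N Y, (N0 <= N)%N ->
    \sum_(N.+1 <= p < Y.+1 | prime p)
      p%:R^-1 * (1 - complex.Re (f p * conjc (g p))) <= e.
Proof.
move=> f1 g1 fin; apply: prime_sum_tail => [p pr|].
  rewrite mulr_ge0 ?invr_ge0 // subr_ge0.
  apply: le_trans (ler_norm _) _; apply: le_trans (Re_le_normc _) _.
  by rewrite normcM normc_conj mulr_ile1 ?normc_ge0 ?f1 ?g1.
change (distance2 f g < +oo)%E.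
by move: fin; rewrite /pretends /distance !ltey; apply: contra_neq => ->.
Qed.

Lemma increasing_from1_ge (a : nat -> int) (m : nat) :
  strictly_increasing_from1 a -> a 1%N = 1 -> (0 < m)%N -> m%:Z <= a m.
Proof.
move=> incr a1; elim: m => // -[|m] IH _; first by rewrite a1.
have := IH isT; have := incr m.+1 m.+2 isT (ltnSn _); lia.
Qed.

Theorem theorem2p17 (R : realType) (f : nat -> R[i]) (hf : is_MRT f) :
  aperiodic f.
Proof.
move=> [u [q [chi [[chiq _] fin]]]].
have [fM f1 [t [s [tincr sincr t1 H]]]] := hf.
have [q0 _ _ chinz] := chiq.
have f1' p : prime p -> normc (f p) = 1.
  by move=> pr; apply: normc_eq1; apply: f1; apply: prime_gt0.
pose k := totient q; have k0 : (0 < k)%N by rewrite totient_gt0.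
have chik p : coprime p q -> chi p ^+ k = 1 by exact: character_totient.
have g1 p : prime p -> normc (npowi u p * chi p) <= 1.
  move=> pr; rewrite normcM normc_npowi mul1r.
  case: (boolP (coprime p q)) => [cop|ncop]; first by rewrite (normc_root1 k0 (chik p cop)).
  have -> : chi p = 0 by apply/eqP; apply: contraNT ncop => /chinz.
  by rewrite normc0.
pose c : R := 1 / 2000 ^+ 3 / 100.
have c0 : 0 < c by rewrite /c; lra.
have kk0 : 0 < k%:R ^+ 2 :> R by rewrite exprn_gt0 // ltr0n.
have e0 : 0 < c / (2 * k%:R ^+ 2) by rewrite divr_gt0 // mulr_gt0.
have f1'' p : prime p -> normc (f p) <= 1 by move=> /f1' ->.
have [N0 hN0] := pretends_sum_tail f1'' g1 fin e0.
(* Primes above q do not divide the conductor, so chi p is a root of unity. *)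
pose N := maxn 1 (maxn q N0).
have N1 : (0 < N)%N by rewrite leq_max.
have qN : (q <= N)%N by rewrite !leq_max leqnn orbT.
have N0N : (N0 <= N)%N by rewrite !leq_max leqnn !orbT.
have k20 : (0 < 2 * k)%N by rewrite muln_gt0 k0.
have [S0 hS0] := prime_oscillation R N k20; rewrite -/c in hS0.
clearbody c.
(* m is taken large enough that s exceeds 1 + |u| and that the errors 1/t_m^2
   on the primes up to t_m contribute at most c / 2. *)
pose x := 1 + `|u| + 2 * k%:R ^+ 2 / c.
have x0 : 0 <= x by rewrite !addr_ge0 // divr_ge0 ?(ltW c0) // mulr_ge0 ?(ltW kk0).
pose m := (S0 + Num.bound x).+1.
have tm := increasing_from1_ge tincr t1 (isT : (0 < m)%N).
have [[ts _ st] fbig fsmall] := H m isT.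
have xm : x <= m%:R.
  apply: ltW; apply: lt_le_trans (archi_boundP x0) _.
  by rewrite ler_nat /m leqW // leq_addl.
case: (t m) (s m.+1) tm ts st fbig fsmall => [T|//] [S|//] tm ts st fbig fsmall.
have mT : (m <= T)%N by rewrite -lez_nat.
have TS : (T < S)%N by rewrite -ltz_nat.
have S0S : (S0 <= S)%N.
  by apply: leq_trans (leq_trans mT (ltnW TS)); rewrite /m leqW // leq_addr.
have T0 : (0 < T)%N by apply: leq_trans mT.
have xT : x <= T%:R by apply: le_trans xm _; rewrite ler_nat.
have xS : x <= S%:R by apply: le_trans xT _; rewrite ler_nat ltnW.
pose v : R := S%:R.
have k1 : 1 <= k%:R :> R by rewrite ler1n.
have quo0 : 0 <= 2 * k%:R ^+ 2 / c by rewrite divr_ge0 ?(ltW c0) // mulr_ge0 // ltW.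
have ht : 1 <= `|k%:R * (v - u)| <= (2 * k * S)%:R.
  have u1 := ler_norm u; have u2 : - u <= `|u| by rewrite -normrN ler_norm.
  have vu : 1 <= v - u by move: xS; rewrite /x /v; lra.
  rewrite ger0_norm; last by rewrite mulr_ge0 //; lra.
  rewrite !natrM -/v; apply/andP; split; first nra.
  have : v - u <= 2 * v by move: xS; rewrite /x /v; lra.
  nra.
have hlow := hS0 S S0S _ ht.
(* The whole range p <= S^2 is covered, as S^2 <= t_{m+1}. *)
have fclose p : prime p -> (p <= S ^ 2)%N ->
    normc (f p - npowi v p) <= if (p <= T)%N then T%:R ^- 2 else 0.
  move=> pr pS; case: (leqP p T) => pT.
    have := fsmall p pr; rewrite lez_nat pT andbT ltz_nat prime_gt1 // => /(_ isT).
    rewrite div1r.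
    have -> : ((T%:Z)%:~R ^- 2 : R[i]) = (T%:R ^- 2 : R)%:C.
      by rewrite fmorphV rmorphXn rmorph_nat.
    by rewrite lecR.
  rewrite fbig ?subrr ?normc0 // ltz_nat pT /=.
  by apply: le_trans st; rewrite -rmorphXn lez_nat.
have term p : (N < p)%N -> prime p -> (p <= S ^ 2)%N ->
    p%:R^-1 * (1 - cos (k%:R * (v - u) * ln p%:R)) <=
    k%:R ^+ 2 * (p%:R^-1 * (1 - complex.Re (f p * conjc (npowi u p * chi p)))) +
    k%:R ^+ 2 * T%:R^-1 * p%:R ^- 2.
  move=> Np pr pS.
  have p0 : (0 < p)%N by exact: prime_gt0.
  have cop : coprime p q.
    rewrite prime_coprime // gtnNdvd //; exact: leq_ltn_trans Np.
  have := one_sub_cos_le u k0 (chik p cop) (fclose p pr pS).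
  set D := if _ then _ else _; set Z := complex.Re _.
  have hD : p%:R^-1 * D <= T%:R^-1 * p%:R ^- 2.
    rewrite /D; case: (leqP p T) => pT; last first.
      by rewrite mulr0 mulr_ge0 // invr_ge0 ?sqr_ge0.
    have p0R : 0 < p%:R :> R by rewrite ltr0n.
    have T0R : 0 < T%:R :> R by rewrite ltr0n.
    have TV : T%:R^-1 <= p%:R^-1 :> R by rewrite lef_pV2 ?posrE // ler_nat.
    have V0 : 0 <= p%:R^-1 * T%:R^-1 :> R by rewrite mulr_ge0 ?invr_ge0.
    have -> : p%:R^-1 * T%:R ^- 2 = p%:R^-1 * T%:R^-1 * T%:R^-1 :> R.
      by rewrite expr2 invfM mulrA.
    have -> : T%:R^-1 * p%:R ^- 2 = p%:R^-1 * T%:R^-1 * p%:R^-1 :> R.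
      by rewrite expr2 invfM mulrCA mulrA.
    exact: ler_wpM2l.
  move=> h; apply: le_trans (ler_wpM2l _ h) _; first by rewrite invr_ge0.
  have := ler_wpM2l (ltW kk0) hD; nra.
have : \sum_(N.+1 <= p < (S ^ 2).+1 | prime p)
    p%:R^-1 * (1 - cos (k%:R * (v - u) * ln p%:R)) <= c.
  apply: (@le_trans _ _ (\sum_(N.+1 <= p < (S ^ 2).+1 | prime p)
     (k%:R ^+ 2 * (p%:R^-1 * (1 - complex.Re (f p * conjc (npowi u p * chi p)))) +
      k%:R ^+ 2 * T%:R^-1 * p%:R ^- 2))).
    rewrite [leLHS]big_nat_cond [leRHS]big_nat_cond; apply: ler_sum => p.
    by move=> /andP[/andP[Np pS] pr]; exact: term.
  rewrite big_split /= -!mulr_sumr.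
  have h1 := hN0 N (S ^ 2)%N N0N.
  have h2 : \sum_(N.+1 <= p < (S ^ 2).+1 | prime p) p%:R ^- 2 <= 1 :> R.
    apply: (@le_trans _ _ (\sum_(N.+1 <= p < (S ^ 2).+1) p%:R ^- 2)).
      rewrite [leLHS]big_mkcond; apply: ler_sum => p _.
      by case: ifP => _; rewrite ?lexx // invr_ge0 exprn_ge0.
    apply: le_trans (sum_inv_sqr_le R _ N1) _.
    by rewrite invf_le1 ?ltr0n // ler1n.
  have h3 : k%:R ^+ 2 * T%:R^-1 <= c / 2.
    rewrite ler_pdivrMr ?ltr0n //.
    have : 2 * k%:R ^+ 2 / c <= T%:R.
      by apply: le_trans xT; rewrite /x lerDr addr_ge0.
    by rewrite ler_pdivrMr //; lra.
  have h4 := ler_wpM2l (ltW kk0) h1.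
  have h5 : k%:R ^+ 2 * (c / (2 * k%:R ^+ 2)) = c / 2.
    by field; rewrite gt_eqF //; lra.
  rewrite h5 in h4; apply: (le_trans (lerD h4 (ler_wpM2l _ h2))).
    by rewrite mulr_ge0 ?invr_ge0 // ltW.
  lra.
by move=> /(lt_le_trans hlow); rewrite ltxx.
Qed.
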